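(* Let $\delta>0$. Suppose that $\sigma_t=\sigma>0$ is constant, that the pairs $(\eta_t,a_t)\in\mathbb{R}\times\{0,1\}$, $t\in\mathbb{Z}$, are independent, and that $E(\eta_t\mid a_t=1)=0$ and $E(\eta_t^2\mid a_t=1)=1$. Assume moreover that all the pairs $(\eta_t,a_t)$ have the same distribution, with $E(|\eta_t|^{4\delta})<\infty$ and $0<P(a_t=1)<1$. Then, for any integer $m\ge 1$, $\sqrt{n}\,\widehat{\Gamma}_s^{(\delta)}(m)$ converges in distribution to $\mathcal{N}(0,I_m)$ as $n\to\infty$, where $I_m$ is the $m\times m$ identity matrix.
   Context: The latent returns are $\widetilde r_t=\sigma_t\eta_t$ with $\sigma_t>0$, and the observed returns are $r_t=a_t\widetilde r_t$, $t=1,\dots,n$, where $a_t\in\{0,1\}$. For each $t$, $\eta_t$ and $a_t$ are allowed to be dependent. The empirical power autocorrelations are $$\widehat{\Gamma}_s^{(\delta)}(m)=\left(\hat\rho_s^{(\delta)}(1),\dots,\hat\rho_s^{(\delta)}(m)\right)',\qquad \hat\rho_s^{(\delta)}(h)=\hat\gamma_s^{(\delta)}(h)\,\hat\gamma_s^{(\delta)}(0)^{-1},$$ $$\hat\gamma_s^{(\delta)}(h)=n^{-1}\sum_{t=1+h}^{n}\left(|r_t|^\delta-\bar r^{(\delta)}\right)\left(|r_{t-h}|^\delta-\bar r^{(\delta)}\right),\qquad \bar r^{(\delta)}=n^{-1}\sum_{t=1}^n|r_t|^\delta .$$ *)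

(* Defs.v *)
From HB Require Import structures.
From mathcomp Require Export all_boot all_order all_algebra finmap.
From mathcomp Require Export all_classical all_reals all_analysis.

Set Implicit Arguments.
Unset Strict Implicit.
Unset Printing Implicit Defensive.

Import Order.TTheory GRing.Theory Num.Theory.
Import numFieldNormedType.Exports.

Local Open Scope classical_set_scope.
Local Open Scope ring_scope.

Section independence.
Context d d' (T : measurableType d) (E : measurableType d') (R : realType).
Variable P : probability T R.

Definition independent_family (I : choiceType) (Z : I -> T -> E) : Prop :=
  forall (J : {fset I}) (B : I -> set E),
    (forall i, i \in J -> measurable (B i)) ->
    P (\bigcap_(i in [set` J]) Z i @^-1` B i) =
    (\prod_(i <- J) P (Z i @^-1` B i))%E.

Definition identically_distributed (I : Type) (Z : I -> T -> E) : Prop :=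
  forall i j (B : set E), measurable B ->
    pushforward P (Z i) B = pushforward P (Z j) B.

(* Elementary conditional expectation given an event A with P A > 0. *)
Definition cond_expectation (X : T -> R) (A : set T) : \bar R :=
  ((fine (P A))^-1%:E * \int[P]_(w in A) (X w)%:E)%E.

End independence.

Section lebesgue_measure_on_tuples.
Context {R : realType}.
Local Notation RB := (measurableTypeR R).

Definition tuple_cons n (p : RB * n.-tuple RB) : n.+1.-tuple RB :=
  [tuple of p.1 :: p.2].

Lemma measurable_tuple_cons n : measurable_fun setT (@tuple_cons n).
Proof. exact: measurable_cons. Qed.

Definition lebesgue_cons n
    (mu : {sigma_finite_measure set (n.-tuple RB) -> \bar R}) :
    set (n.+1.-tuple RB) -> \bar R :=
  pushforward (lebesgue_measure \x mu)%E (@tuple_cons n).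

Section cons_sigma_finite.
Variable n : nat.
Variable mu : {sigma_finite_measure set (n.-tuple RB) -> \bar R}.

Let cons_measure : {measure set (n.+1.-tuple RB) -> \bar R}.
Proof.
by refine (pushforward (lebesgue_measure \x mu)%E (@tuple_cons n) :
  {measure set (n.+1.-tuple RB) -> \bar R}); exact: measurable_tuple_cons.
Defined.

HB.instance Definition _ := isMeasure.Build _ _ _ (lebesgue_cons mu)
  (measure0 cons_measure) (measure_ge0 cons_measure)
  (@measure_semi_sigma_additive _ _ _ cons_measure).

Let lebesgue_cons_sigma_finite : sigma_finite setT (lebesgue_cons mu).
Proof.
have /sigma_finiteP[F [TF ndF Foo]] :=
  sigma_finiteT (lebesgue_measure : {sigma_finite_measure set RB -> \bar R}).
have /sigma_finiteP[G [TG ndG Goo]] := sigma_finiteT mu.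
pose unc (t : n.+1.-tuple RB) : RB * n.-tuple RB :=
  (thead t, [tuple of behead t]).
have uncK p : unc (tuple_cons p) = p.
  case: p => x t; rewrite /unc /tuple_cons /=; congr pair; exact: val_inj.
have munc : measurable_fun setT unc.
  apply/measurable_fun_pair; last exact: measurable_behead.
  exact: (@measurable_tnth _ _ n.+1 ord0).
exists (fun k => unc @^-1` (F k `*` G k)).
  apply/seteqP; split=> // t _.
  have [i _ Fi] : (\bigcup_k F k) (unc t).1 by rewrite -TF.
  have [j _ Gj] : (\bigcup_k G k) (unc t).2 by rewrite -TG.
  exists (maxn i j) => //; split.
    by move: Fi; exact/subsetPset/ndF/leq_maxl.
  by move: Gj; exact/subsetPset/ndG/leq_maxr.
move=> k; have [mFk Fkoo] := Foo k; have [mGk Gkoo] := Goo k; split.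
  by rewrite -[X in measurable X]setTI; apply: munc => //; exact: measurableX.
rewrite /lebesgue_cons /pushforward.
rewrite -comp_preimage (_ : unc \o _ = id); last exact/funext/uncK.
rewrite preimage_id.
by rewrite product_measure1E// lte_mul_pinfty// ge0_fin_numE.
Qed.

HB.instance Definition _ := Measure_isSigmaFinite.Build _ _ _
  (lebesgue_cons mu) lebesgue_cons_sigma_finite.

End cons_sigma_finite.

(* The n-fold product of Lebesgue measure on R, built one coordinate at a time. *)
Fixpoint lebesgue_tuple n : {sigma_finite_measure set (n.-tuple RB) -> \bar R} :=
  if n is k.+1 then lebesgue_cons (lebesgue_tuple k) else \d_[tuple].

End lebesgue_measure_on_tuples.

Section multivariate_normal.
Context {R : realType} {m : nat}.

(* Measurable sets live on m.-tuple R and the topology of R^m on 'rV[R]_m. *)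
Definition row_of_tuple (t : m.-tuple (measurableTypeR R)) : 'rV[R]_m := \row_i tnth t i.

Definition mvnormal_pdf (b : 'rV[R]_m) (S : 'M[R]_m) (x : 'rV[R]_m) : R :=
  (Num.sqrt ((2 * pi) ^+ m * \det S))^-1 *
  expR (- ((x - b) *m invmx S *m (x - b)^T) 0 0 / 2).

(* The normal law N(b, S), for a positive definite covariance matrix S. *)
Definition mvnormal (b : 'rV[R]_m) (S : 'M[R]_m) (A : set 'rV[R]_m) : \bar R :=
  (\int[lebesgue_tuple m]_(t in row_of_tuple @^-1` A)
     (mvnormal_pdf b S (row_of_tuple t))%:E)%E.

(* Distribution function of the law mu, with values in \bar R like [cdf]. *)
Definition joint_cdf (mu : set 'rV[R]_m -> \bar R) (x : 'rV[R]_m) : \bar R :=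
  mu [set y | forall i, y 0 i <= x 0 i].

Definition cvg_in_distribution d (T : measurableType d) (P : probability T R)
    (X : nat -> T -> 'rV[R]_m) (mu : set 'rV[R]_m -> \bar R) : Prop :=
  forall x : 'rV[R]_m, {for x, continuous (joint_cdf mu)} ->
    (fun n => joint_cdf (fun A => P (X n @^-1` A)) x) @ \oo --> joint_cdf mu x.

End multivariate_normal.

Section returns.
Context d (T : measurableType d) (R : realType) (P : probability T R).
Variables (vol : int -> T -> R).
Variables (eta : int -> {RV P >-> R}) (a : int -> {RV P >-> bool}).

Definition innovation_pair (t : int) (w : T) : R * bool := (eta t w, a t w).

Definition latent_return (t : int) (w : T) : R := vol t w * eta t w.

Definition observed_return (t : int) (w : T) : R :=
  (a t w)%:R * latent_return t w.

End returns.

(* Only the observations x_1, ..., x_n of the series enter. *)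
Section sample_statistics.
Context {R : realType}.
Implicit Types (n h : nat) (x : int -> R).

Definition sample_mean n x : R := n%:R^-1 * \sum_(1 <= t < n.+1) x t%:Z.

Definition sample_autocov n x h : R :=
  n%:R^-1 * \sum_(1 + h <= t < n.+1)
    (x t%:Z - sample_mean n x) * (x (t%:Z - h%:Z) - sample_mean n x).

(* The value is 0 when the sample variance vanishes. *)
Definition sample_autocorr n x h : R :=
  sample_autocov n x h * (sample_autocov n x 0)^-1.

Definition power_autocorr_vector (delta : R) m n (r : int -> R) : 'rV[R]_m :=
  \row_(i < m) sample_autocorr n (fun t => `|r t| `^ delta) i.+1.

End sample_statistics.

(* Main.v *)
(* Up to an affine change of scale, which does not affect autocorrelations, the
   power returns are an i.i.d. sequence y_t with mean 0, variance 1 and finite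
   fourth moment; the variance is positive because the returns vanish when
   a_t = 0 but not identically. Up to O(1 / sqrt n) in L^1, the numerators
   sqrt n * gamma(h) are the sums S_n(h) = n^(-1/2) sum_(t <= n) y_t y_(t-h), and
   gamma(0) is 1.

   The joint convergence of the S_n(h) is proved by Lindeberg's method, without
   characteristic functions. With Phi the standard normal distribution function,
   G_t(x) = prod_h Phi ((c_h - x_h) / sqrt (1 + eps - t)) solves the backward heat
   equation, so the second order Taylor expansion of
   G_((k+1)/n) (S_(k+1)) - G_(k/n) (S_k) consists of a linear term in the
   martingale increment and of second derivatives of G multiplied by
   y^2 y_(-i) y_(-j) - delta_ij. Evaluating these derivatives at S_(k-m) instead
   of S_k makes them independent of that factor, at the cost of an error of the
   same order n^(-3/2) as the Taylor remainder. Summing over k, the expectation of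
   G_1 (S_n), a smoothed indicator, tends to G_0 (0), a product of values of Phi. *)

From HB Require Import structures.
Require Import Defs.
From mathcomp Require Import all_boot all_order all_algebra.
From mathcomp Require Import all_classical all_reals all_analysis.
From mathcomp Require Import measurable_realfun zify ring lra.

Set Implicit Arguments.
Unset Strict Implicit.
Unset Printing Implicit Defensive.

Import Order.TTheory GRing.Theory Num.Theory.
Import numFieldNormedType.Exports.

Local Open Scope classical_set_scope.
Local Open Scope ring_scope.

(** * Expectations and independence *)

(** The summands [y_t y_(t-h)] are martingale differences but not independent, and their conditional
    covariance given the past is the random matrix of the [y_(t-i) y_(t-j)], not the identity. The
    second order term of a replacement step thus vanishes only in mean, and only against a weight
    independent of those [m] past values: this is what imposes freezing the weight. The Gaussian
    partner never appears as a random variable; the running time of the heat flow stands for it,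
    [1 / n] per observation. The smoothing has variance [eta ^ 4], so its width [eta ^ 2] is
    negligible against the shift [eta] given to the thresholds. For fixed [eta] all errors are
    [O (1 / sqrt n)] with a constant depending on [eta]; [n] tends to infinity first, [eta] to 0
    afterwards. The fourth moment serves the sample variance, through the variance of [y_t ^ 2]; the
    Lindeberg steps use third moments only. *)

Section expectation.
Context d (T : measurableType d) (R : realType) (P : probability T R).
Implicit Types f g : T -> R.

Definition integrable_rv f := P.-integrable setT (EFin \o f).
Definition mean f : R := (\int[P]_w f w)%R.

Lemma integrable_rv_measurable f : integrable_rv f -> measurable_fun setT f.
Proof. by move=> /measurable_int /measurable_EFinP. Qed.

Lemma eq_integrable_rv f g : f =1 g -> integrable_rv f -> integrable_rv g.
Proof. by move=> /funext ->. Qed.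

Lemma eq_mean f g : f =1 g -> mean f = mean g.
Proof. by move=> /funext ->. Qed.

Lemma integrable_rv_cst (c : R) : integrable_rv (fun=> c).
Proof. exact: finite_measure_integrable_cst. Qed.

Lemma integrable_rvD f g : integrable_rv f -> integrable_rv g ->
  integrable_rv (fun w => f w + g w).
Proof. by move=> intf intg; exact: (integrableD measurableT intf intg). Qed.

Lemma integrable_rvB f g : integrable_rv f -> integrable_rv g ->
  integrable_rv (fun w => f w - g w).
Proof. by move=> intf intg; exact: (integrableB measurableT intf intg). Qed.

Lemma integrable_rvZ (c : R) f : integrable_rv f ->
  integrable_rv (fun w => c * f w).
Proof. by move=> intf; exact: (integrableZl measurableT c intf). Qed.

Lemma integrable_rv_sum (I : Type) (r : seq I) (Q : pred I) (F : I -> T -> R) :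
  (forall i, Q i -> integrable_rv (F i)) ->
  integrable_rv (fun w => \sum_(i <- r | Q i) F i w).
Proof.
move=> intF; elim: r => [|i r IH].
  by apply: eq_integrable_rv (integrable_rv_cst 0) => w; rewrite big_nil.
case Qi : (Q i); last by apply: eq_integrable_rv IH => w; rewrite big_cons Qi.
apply: (@eq_integrable_rv (fun w => F i w + \sum_(j <- r | Q j) F j w)).
  by move=> w; rewrite big_cons Qi.
apply: integrable_rvD => //; exact: intF.
Qed.

Lemma integrable_rv_le f g : measurable_fun setT f -> integrable_rv g ->
  (forall w, `|f w| <= g w) -> integrable_rv f.
Proof.
move=> mf ig fg; apply: le_integrable ig => //; first exact/measurable_EFinP.
by move=> w _ /=; rewrite lee_fin (le_trans (fg w))// ler_norm.
Qed.

Lemma mean_cst (c : R) : mean (fun=> c) = c.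
Proof. by rewrite /mean Rintegral_cst//= probability_setT mulr1. Qed.

Lemma meanD f g : integrable_rv f -> integrable_rv g ->
  mean (fun w => f w + g w) = mean f + mean g.
Proof. exact: (RintegralD measurableT). Qed.

Lemma meanB f g : integrable_rv f -> integrable_rv g ->
  mean (fun w => f w - g w) = mean f - mean g.
Proof. exact: (RintegralB measurableT). Qed.

Lemma meanZ (c : R) f : integrable_rv f ->
  mean (fun w => c * f w) = c * mean f.
Proof. exact: (RintegralZl c measurableT). Qed.

Lemma mean_sum (I : Type) (r : seq I) (Q : pred I) (F : I -> T -> R) :
  (forall i, Q i -> integrable_rv (F i)) ->
  mean (fun w => \sum_(i <- r | Q i) F i w) = \sum_(i <- r | Q i) mean (F i).
Proof.
move=> intF; elim: r => [|i r IH].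
  by rewrite big_nil (@eq_mean _ (fun=> 0)) ?mean_cst// => w; rewrite big_nil.
rewrite big_cons; case Qi : (Q i); last first.
  by rewrite -IH; apply: eq_mean => w; rewrite big_cons Qi.
rewrite -IH -meanD; [|exact: intF|exact: integrable_rv_sum].
by apply: eq_mean => w; rewrite big_cons Qi.
Qed.

Lemma le_mean f g : integrable_rv f -> integrable_rv g ->
  (forall w, f w <= g w) -> mean f <= mean g.
Proof. by move=> *; exact: le_Rintegral. Qed.

Lemma mean_ge0 f : (forall w, 0 <= f w) -> 0 <= mean f.
Proof. by move=> f0; exact: Rintegral_ge0. Qed.

Lemma le_normr_mean f g : measurable_fun setT f -> integrable_rv g ->
  (forall w, `|f w| <= g w) -> `|mean f| <= mean g.
Proof.
move=> mf ig fg; have intf := integrable_rv_le mf ig fg.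
apply: le_trans (le_normr_Rintegral _ intf) _ => //.
apply: le_mean => //; apply: integrable_rv_le (ig) _ => [|w].
  exact: measurableT_comp.
by rewrite normr_id.
Qed.

Lemma mean_indic (A : set T) : measurable A -> mean \1_A = fine (P A).
Proof. by move=> mA; rewrite /mean /Rintegral integral_indic// setIT. Qed.

Lemma integrable_rv_indic (A : set T) : measurable A -> integrable_rv \1_A.
Proof.
move=> mA; apply: (integrable_rv_le _ (integrable_rv_cst 1)) => [|w].
  exact: measurable_indic.
by rewrite indicE; case: (_ \in _); rewrite /= ?normr1 ?normr0.
Qed.

(** The law of [(f, g)] and the product of the two laws agree on rectangles, hence everywhere.
    Tonelli applied to [|x| * |y|] gives integrability of the product, Fubini its mean. *)
Lemma mean_mul_independent f g :
    (forall A B : set R, measurable A -> measurable B ->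
      P (f @^-1` A `&` g @^-1` B) = (P (f @^-1` A) * P (g @^-1` B))%E) ->
    integrable_rv f -> integrable_rv g ->
  integrable_rv (fun w => f w * g w) /\
  mean (fun w => f w * g w) = mean f * mean g.
Proof.
move=> indep intf intg.
have mf := integrable_rv_measurable intf.
have mg := integrable_rv_measurable intg.
pose X : {RV P >-> R} := HB.pack f (isMeasurableFun.Build _ _ _ _ _ mf).
pose Y : {RV P >-> R} := HB.pack g (isMeasurableFun.Build _ _ _ _ _ mg).
pose h w := (f w, g w).
have mh : measurable_fun setT h by exact/measurable_fun_pair.
pose Z : {RV P >-> (R * R)%type} := HB.pack h (isMeasurableFun.Build _ _ _ _ _ mh).
pose m1 := distribution P X; pose m2 := distribution P Y.
have jointE A : measurable A -> (m1 \x m2)%E A = distribution P Z A.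
  by apply: product_measure_unique => B C mB mC; rewrite /= -indep.
pose k (p : R * R) : \bar R := (p.1 * p.2)%:E.
have mk : measurable_fun setT k.
  by apply/measurable_EFinP; apply: measurable_funM => /=;
    [exact: measurable_fst|exact: measurable_snd].
have intX : m1.-integrable setT EFin.
  by apply: (@integrable_pushforward _ _ _ _ _ X) => //; rewrite preimage_setT.
have intY : m2.-integrable setT EFin.
  by apply: (@integrable_pushforward _ _ _ _ _ Y) => //; rewrite preimage_setT.
have intk : (m1 \x m2)%E.-integrable setT k.
  apply/(@integrable12ltyP _ _ _ _ _ m1 m2 k) => //.
  have [mI1 I1oo] := integrableP _ _ _ intX.
  have [mI2 I2oo] := integrableP _ _ _ intY.
  rewrite (eq_integral (fun x : R => `|x%:E| * \int[m2]_y `|y%:E|))%E.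
    rewrite ge0_integralZr//=; last 2 first.
    - exact: measurableT_comp.
    - exact: integral_ge0.
    apply: lte_mul_pinfty => //; first exact: integral_ge0.
    by rewrite ge0_fin_numE//; exact: integral_ge0.
  move=> x _; rewrite -ge0_integralZl//=.
  - by apply: eq_integral => y _; rewrite normrM.
  - exact: measurableT_comp.
have intZ : P.-integrable setT (k \o Z).
  apply/integrableP; split; first exact: measurableT_comp.
  have [_] := integrableP _ _ _ intk.
  rewrite (eq_measure_integral (distribution P Z)); last first.
    by move=> A mA _; exact: jointE.
  by rewrite ge0_integral_distribution//; exact: measurableT_comp.
split=> //; rewrite /mean /Rintegral.
transitivity (fine (\int[(m1 \x m2)%E]_p k p)).
  congr fine; rewrite [RHS](eq_measure_integral (distribution P Z)); last first.
    by move=> A mA _; exact: jointE.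
  by rewrite integral_distribution.
rewrite -(@integral12_prod_meas1 _ _ _ _ _ m1 m2 k)//.
have intE (V : {RV P >-> R}) : integrable_rv V ->
    (\int[distribution P V]_x x%:E = (mean V)%:E)%E.
  move=> intV; rewrite integral_distribution; [|by []|exact: intV].
  by rewrite /mean /Rintegral fineK//; exact: integrable_fin_num.
rewrite (eq_integral (fun x : R => (mean g)%:E * x%:E))%E => [|x _].
  by rewrite integralZl// (intE X)//= mulrC.
transitivity (\int[m2]_y (x%:E * y%:E))%E; first by [].
by rewrite integralZl// (intE Y)// muleC.
Qed.
End expectation.

(** Nothing is asked of [h i] outside the range: for the sigma-algebra of a window, only the
    coordinates inside are known to be measurable. *)
Lemma measurable_sum_nat d (T : measurableType d) (R : realType) (D : set T)
    a b (h : nat -> T -> R) :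
  (forall i, (a <= i < b)%N -> measurable_fun D (h i)) ->
  measurable_fun D (fun w => \sum_(a <= i < b) h i w).
Proof.
move=> mh; have e : (fun w => \sum_(a <= i < b) h i w) = (fun w =>
    \sum_(i <- index_iota a b) if (a <= i < b)%N then h i w else 0).
  by apply: funext => w; rewrite [LHS]big_nat [LHS]big_mkcond.
rewrite e; apply: measurable_sum => i; case: (boolP (a <= i < b)%N) => [|_].
  exact: mh.
exact: measurable_cst.
Qed.

(** * Independence of disjoint windows of consecutive indices *)

Section independent_windows.
Context d (T : measurableType d) (R : realType) (P : probability T R).
Variable Z : nat -> T -> R.
Implicit Types (a b c : nat) (f g : T -> R).

(** Rectangles in the coordinates [a, ..., b - 1]: a pi-system generating their sigma-algebra, the
    form that uniqueness of measures requires. *)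
Definition window a b : set (set T) :=
  [set A | exists2 B : nat -> set R, (forall i, measurable (B i)) &
           A = \big[setI/setT]_(a <= i < b) Z i @^-1` B i].

(** Intervals of indices are enough: a coordinate to be left out gets [B i = setT]. *)
Definition independent_seq := forall a b (B : nat -> set R),
  (forall i, measurable (B i)) ->
  P (\big[setI/setT]_(a <= i < b) Z i @^-1` B i) =
  (\prod_(a <= i < b) P (Z i @^-1` B i))%E.

(** The ascription replaces the ambient sigma-algebra of [T] by the one of the window, so that the
    usual closure properties of measurable functions express dependence on these coordinates
    alone. *)
Definition window_measurable a b f :=
  measurable_fun setT (f : g_sigma_algebraType (window a b) -> R).

Hypothesis mZ : forall i, measurable_fun setT (Z i).
Hypothesis indepZ : independent_seq.

Lemma window_sub a b : window a b `<=` measurable.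
Proof.
move=> _ [B mB ->]; apply: bigsetI_measurable => i _.
by rewrite -[X in measurable X]setTI; exact: mZ.
Qed.

Lemma window_setI a b : setI_closed (window a b).
Proof.
move=> _ _ [B mB ->] [C mC ->]; exists (fun i => B i `&` C i).
  by move=> i; exact: measurableI.
by rewrite -big_split.
Qed.

Lemma window_setT a b : window a b setT.
Proof. by exists (fun=> setT) => //; rewrite big1. Qed.

Lemma sigma_window_sub a b : <<s window a b >> `<=` measurable.
Proof.
apply: smallest_sub; last exact: window_sub.
exact: sigma_algebra_measurable.
Qed.

Lemma window_measurable_coord a b i : (a <= i < b)%N ->
  window_measurable a b (Z i).
Proof.
move=> /andP[ai ib] _ B mB; rewrite setTI; apply: sub_sigma_algebra.
exists (fun j => if j == i then B else setT) => [j|]; first by case: ifP.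
have ri : i \in index_iota a b by rewrite mem_index_iota ai.
rewrite (bigD1_seq i)//= ?iota_uniq// eqxx big1 ?setIT// => j /negPf ->.
exact: preimage_setT.
Qed.

Lemma window_measurable_measurable a b f :
  window_measurable a b f -> measurable_fun setT f.
Proof.
move=> mf _ B mB; apply: (@sigma_window_sub a b).
by apply: mf => //; exact: measurableT.
Qed.

(** Dynkin's argument on each side in turn: with one event fixed, the probability of the
    intersection with it and the corresponding multiple of [P] are finite measures that agree on the
    rectangles. *)
Lemma sigma_window_independent a b c A B : (a <= b <= c)%N ->
  <<s window a b >> A -> <<s window b c >> B -> P (A `&` B) = (P A * P B)%E.
Proof.
move=> /andP[ab bc] sA sB.
have extend a' b' B' (mB' : measurable B') :
    (forall A', window a' b' A' -> P (A' `&` B') = (P A' * P B')%E) ->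
    forall A', <<s window a' b' >> A' -> P (A' `&` B') = (P A' * P B')%E.
  move=> indepB' A' sA'.
  have PB0 : 0 <= fine (P B') by exact: fine_ge0.
  have -> : (P A' * P B' = mscale (NngNum PB0) P A')%E.
    by rewrite /mscale /= fineK ?fin_num_measure// muleC.
  apply: (@g_sigma_algebra_measure_unique _ _ _ (window a' b') _ (fun=> setT)
    _ _ (mrestr P mB') (mscale (NngNum PB0) P)) => //.
  - exact: window_sub.
  - by move=> _; exact: window_setT.
  - by rewrite bigcup_const.
  - exact: window_setI.
  - move=> A'' wA''; apply: (etrans (indepB' _ wA'')).
    by rewrite /= /mscale /= fineK ?fin_num_measure// muleC.
  - move=> _; rewrite -ge0_fin_numE//; apply: fin_num_measure; exact: measurableT.
apply: (extend a b B) sA => [|A' wA']; first exact: sigma_window_sub sB.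
rewrite setIC muleC; apply: (extend b c A') sB => [|B' wB'].
  exact: window_sub wA'.
have [C mC ->] := wB'; have [D mD ->] := wA'.
(* Over [a <= i < c] the two rectangles form one rectangle with sides [E], so the product formula
   applies to the whole range and to each part. *)
pose E i := if (i < b)%N then D i else C i.
have mE i : measurable (E i) by rewrite /E; case: ifP.
have ED : \big[setI/setT]_(a <= i < b) Z i @^-1` D i =
          \big[setI/setT]_(a <= i < b) Z i @^-1` E i.
  by apply: eq_big_nat => i /andP[_ ib]; rewrite /E ib.
have EC : \big[setI/setT]_(b <= i < c) Z i @^-1` C i =
          \big[setI/setT]_(b <= i < c) Z i @^-1` E i.
  by apply: eq_big_nat => i /andP[ib _]; rewrite /E ltnNge ib.
rewrite ED EC setIC -big_cat_nat// !indepZ//.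
by rewrite muleC -big_cat_nat.
Qed.

Lemma mean_mul_windows a b c f g : (a <= b <= c)%N ->
  window_measurable a b f -> window_measurable b c g ->
  integrable_rv P f -> integrable_rv P g ->
  integrable_rv P (fun w => f w * g w) /\
  mean P (fun w => f w * g w) = mean P f * mean P g.
Proof.
move=> abc mf mg intf intg; apply: mean_mul_independent => // A B mA mB.
apply: (sigma_window_independent abc).
- by rewrite -[X in <<s _ >> X]setTI; exact: mf.
- by rewrite -[X in <<s _ >> X]setTI; exact: mg.
Qed.

Lemma mean_prod_window (h : R -> R) (M : R) a b : (a <= b)%N ->
  measurable_fun setT h ->
  (forall i, integrable_rv P (h \o Z i)) ->
  (forall i, mean P (h \o Z i) = M) ->
  integrable_rv P (fun w => \prod_(a <= i < b) h (Z i w)) /\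
  mean P (fun w => \prod_(a <= i < b) h (Z i w)) = M ^+ (b - a).
Proof.
move=> ab mh inth hM; rewrite -(subnKC ab); move: (b - a)%N => {ab b} k.
rewrite addKn.
elim: k => [|k [intk meank]].
  have e w : 1 = \prod_(a <= i < a + 0) h (Z i w).
    by rewrite big_geq// addn0.
  split; first exact: eq_integrable_rv e (integrable_rv_cst _ _).
  by rewrite -(eq_mean _ e) mean_cst.
have e w : \prod_(a <= i < a + k) h (Z i w) * (h \o Z (a + k)%N) w =
    \prod_(a <= i < a + k.+1) h (Z i w).
  by rewrite addnS big_nat_recr ?leq_addr.
have [|||||i1 i2] := @mean_mul_windows a (a + k) (a + k.+1)
  (fun w => \prod_(a <= i < a + k) h (Z i w)) (h \o Z (a + k)%N).
- by rewrite leq_addr/= leq_add2l leqnSn.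
- rewrite /window_measurable.
  apply: measurable_prod => i; rewrite mem_index_iota => aik.
  by apply: measurableT_comp => //; exact: window_measurable_coord.
- apply: measurableT_comp => //; apply: window_measurable_coord.
  by rewrite leqnn /= addnS.
- exact: intk.
- exact: inth.
by split; [exact: eq_integrable_rv e i1|rewrite -(eq_mean _ e) i2 meank hM exprSr].
Qed.

(** By induction on the length: the last term is centered and independent of the earlier sum, so the
    cross term drops. *)
Lemma mean_sum_sqr (h : R -> R) (V : R) a b : (a <= b)%N ->
  measurable_fun setT h ->
  (forall i, integrable_rv P (h \o Z i)) ->
  (forall i, integrable_rv P (fun w => h (Z i w) ^+ 2)) ->
  (forall i, mean P (h \o Z i) = 0) ->
  (forall i, mean P (fun w => h (Z i w) ^+ 2) = V) ->
  integrable_rv P (fun w => (\sum_(a <= i < b) h (Z i w)) ^+ 2) /\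
  mean P (fun w => (\sum_(a <= i < b) h (Z i w)) ^+ 2) = (b - a)%:R * V.
Proof.
move=> ab mh inth inth2 h0 hV; rewrite -(subnKC ab); move: (b - a)%N => {ab b} k.
rewrite addKn.
elim: k => [|k [intk meank]].
  have e w : 0 = (\sum_(a <= i < a + 0) h (Z i w)) ^+ 2.
    by rewrite big_geq ?addn0// expr0n.
  split; first exact: eq_integrable_rv e (integrable_rv_cst _ _).
  by rewrite -(eq_mean _ e) mean_cst mul0r.
have ints : integrable_rv P (fun w => \sum_(a <= i < a + k) h (Z i w)).
  by apply: integrable_rv_sum => i _; exact: inth.
have [|||||i1 i2] := @mean_mul_windows a (a + k) (a + k.+1)
  (fun w => \sum_(a <= i < a + k) h (Z i w)) (h \o Z (a + k)%N).
- by rewrite leq_addr/= leq_add2l leqnSn.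
- rewrite /window_measurable.
  apply: measurable_sum_nat => i aik.
  by apply: measurableT_comp => //; exact: window_measurable_coord.
- apply: measurableT_comp => //; apply: window_measurable_coord.
  by rewrite leqnn /= addnS.
- exact: ints.
- exact: inth.
have e w : (\sum_(a <= i < a + k) h (Z i w)) ^+ 2 +
    2 * ((\sum_(a <= i < a + k) h (Z i w)) * (h \o Z (a + k)%N) w) +
    h (Z (a + k)%N w) ^+ 2 =
    (\sum_(a <= i < a + k.+1) h (Z i w)) ^+ 2.
  by rewrite addnS big_nat_recr ?leq_addr//=; ring.
have i3 := integrable_rvZ 2 i1.
have i4 := integrable_rvD intk i3.
split; first by apply: eq_integrable_rv e _; exact: integrable_rvD.
rewrite -(eq_mean _ e) meanD// meanD// meank hV meanZ// i2 h0 !mulr0 addr0.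
by rewrite -[k.+1%:R]natr1 mulrDl mul1r.
Qed.

End independent_windows.

(** * The Gaussian distribution function and the heat flow *)

Section taylor_bounds.
Context {R : realType}.
Implicit Types a x y K : R.

(** The intermediate point is located by its distances to [x] and [y], which makes their order
    immaterial. The half-line serves the time variable, where derivatives are bounded only from
    [eps] on. *)
Lemma mvt_ray (f f' : R -> R) a x y :
  (forall z, a <= z -> is_derive z 1 f (f' z)) -> a <= x -> a <= y ->
  exists c, [/\ a <= c, `|c - x| <= `|y - x|, `|c - y| <= `|y - x| &
    f y - f x = f' c * (y - x)].
Proof.
move=> df; wlog xy : x y / x <= y => [hw|] ax ay.
  have [xy|/ltW yx] := leP x y; first exact: hw.
  have [c [ac cy cx fc]] := hw _ _ yx ay ax.
  exists c; rewrite (distrC y x); split=> //.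
  by rewrite -opprB fc -mulrN opprB.
have [||c] := @MVT_segment _ f f' x y xy.
- by move=> z /itvP zxy; apply: df; rewrite (le_trans ax)// zxy.
- apply: derivable_within_continuous => z /itvP zxy.
  by have [] : is_derive z 1 f (f' z) by apply: df; rewrite (le_trans ax)// zxy.
move=> /itvP cxy fc; exists c; split=> //; first by rewrite (le_trans ax)// cxy.
  by rewrite !ger0_norm ?subr_ge0// ?cxy// lerD2r cxy.
by rewrite ler0_norm ?subr_le0 ?cxy// ger0_norm ?subr_ge0// opprB lerD2l lerN2 cxy.
Qed.

Lemma lipschitz_ray (f f' : R -> R) a K :
  (forall z, a <= z -> is_derive z 1 f (f' z)) ->
  (forall z, a <= z -> `|f' z| <= K) ->
  forall x y, a <= x -> a <= y -> `|f y - f x| <= K * `|y - x|.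
Proof.
move=> df f'K x y ax ay; have [c [ac _ _ ->]] := mvt_ray df ax ay.
by rewrite normrM ler_wpM2r// f'K.
Qed.

Lemma taylor1_ray (f f' : R -> R) a K : 0 <= K ->
  (forall z, a <= z -> is_derive z 1 f (f' z)) ->
  (forall x y, a <= x -> a <= y -> `|f' y - f' x| <= K * `|y - x|) ->
  forall x y, a <= x -> a <= y ->
  `|f y - f x - f' x * (y - x)| <= K * `|y - x| ^+ 2.
Proof.
move=> K0 df f'K x y ax ay; have [c [ac cx _ ->]] := mvt_ray df ax ay.
rewrite -mulrBl normrM expr2 mulrA ler_wpM2r//.
by rewrite (le_trans (f'K _ _ ax ac))// ler_wpM2l.
Qed.

(** The remainder [g] vanishes at [x], and its derivative is the first order remainder of [f']. The
    factor [1/6] of the sharp constant is given up. *)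
Lemma taylor2_ray (f f' f'' : R -> R) a K : 0 <= K ->
  (forall z, a <= z -> is_derive z 1 f (f' z)) ->
  (forall z, a <= z -> is_derive z 1 f' (f'' z)) ->
  (forall x y, a <= x -> a <= y -> `|f'' y - f'' x| <= K * `|y - x|) ->
  forall x y, a <= x -> a <= y ->
  `|f y - f x - f' x * (y - x) - 2^-1 * f'' x * (y - x) ^+ 2| <=
  K * `|y - x| ^+ 3.
Proof.
move=> K0 df df' f''K x y ax ay.
pose g z := f z - f x - f' x * (z - x) - 2^-1 * f'' x * (z - x) ^+ 2.
pose g' z := f' z - f' x - f'' x * (z - x).
have dg z : a <= z -> is_derive z 1 g (g' z).
  move=> az; have dfz := df z az.
  by rewrite /g /g'; apply: is_derive_eq; rewrite /GRing.scale /=; field.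
have [c [ac cx _]] := mvt_ray dg ax ay.
have -> : g x = 0 by rewrite /g !subrr expr0n /= !mulr0 !subr0.
rewrite subr0 -/(g y) => ->.
rewrite normrM exprSr mulrA ler_wpM2r//.
rewrite (le_trans (taylor1_ray K0 df' f''K ax ac))// ler_wpM2l//.
by rewrite lerXn2r ?nnegrE.
Qed.

End taylor_bounds.

Section gaussian_cdf.
Context {R : realType}.
Implicit Types x y z : R.

Local Notation mu := (@lebesgue_measure R).

Definition gauss_pdf : R -> R := normal_pdf 0 1.

Definition gauss_cdf x : R := (\int[mu]_(t in `]-oo, x]) gauss_pdf t)%R.

Lemma gauss_pdfE x : gauss_pdf x = normal_peak 1 * expR (- (x ^+ 2 / 2)).
Proof.
by rewrite /gauss_pdf normal_pdfE ?oner_eq0// /normal_fun subr0 expr1n mulNr.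
Qed.

Lemma gauss_pdf_ge0 x : 0 <= gauss_pdf x.
Proof. exact: normal_pdf_ge0. Qed.

Lemma is_derive_gauss_pdf x : is_derive x 1 gauss_pdf (- x * gauss_pdf x).
Proof.
rewrite (_ : gauss_pdf = fun x => normal_peak 1 * expR (- (x ^+ 2 / 2))).
  by apply: is_derive_eq; rewrite /GRing.scale /=; field.
by apply/funext => z; rewrite gauss_pdfE.
Qed.

Lemma is_derive_gauss_cdf x : is_derive x 1 gauss_cdf (gauss_pdf x).
Proof.
have [||||dF <-] := @continuous_FTC1 _ gauss_pdf -oo%O x (x + 1).
- by rewrite ltrDl.
- by apply: (integrableS _ _ (subsetT _)) => //; exact: integrable_normal_pdf.
- by rewrite ltNyr.
- exact/continuous_normal_pdf/oner_neq0.
by split=> //; rewrite derive1E.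
Qed.

Lemma gauss_cdf_prob x : (gauss_cdf x)%:E = normal_prob 0 1 `]-oo, x].
Proof.
rewrite /gauss_cdf /Rintegral fineK// -[X in X \is a _]/(normal_prob 0 1 _).
exact: fin_num_measure.
Qed.

Lemma gauss_cdf_ge0 x : 0 <= gauss_cdf x.
Proof. by rewrite -lee_fin gauss_cdf_prob. Qed.

Lemma gauss_cdf_le1 x : gauss_cdf x <= 1.
Proof. by rewrite -lee_fin gauss_cdf_prob; exact: probability_le1. Qed.

Lemma gauss_cdf_nondecreasing : {homo gauss_cdf : x y / x <= y}.
Proof.
move=> x y xy; rewrite -lee_fin !gauss_cdf_prob.
by rewrite le_measure ?inE//; exact: subitvPr.
Qed.

Lemma continuous_gauss_cdf : continuous gauss_cdf.
Proof.
move=> x; apply: differentiable_continuous; apply/derivable1_diffP.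
by have [] := is_derive_gauss_cdf x.
Qed.

Lemma measurable_gauss_cdf : measurable_fun setT gauss_cdf.
Proof. exact: continuous_measurable_fun continuous_gauss_cdf. Qed.

Lemma measurable_gauss_pdf : measurable_fun setT gauss_pdf.
Proof. exact: measurable_normal_pdf. Qed.

Let idfunR : measurableTypeR R -> R := idfun.

Let measurable_idfunR : measurable_fun setT idfunR.
Proof. exact: measurable_id. Qed.

(** The identity under the normal law is a random variable with distribution function [gauss_cdf],
    whose limits at infinity are then those of any [cdf]. *)
Let idN : {RV (normal_prob (0 : R) 1) >-> R} := HB.pack idfunR
  (isMeasurableFun.Build _ _ _ _ _ measurable_idfunR).

Lemma cvg_gauss_cdfy : gauss_cdf x @[x --> +oo] --> (1 : R).
Proof.
rewrite (_ : gauss_cdf = fine \o cdf idN).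
  by have /fine_cvgP[] := cvg_cdfy1 idN.
by apply/funext => x; rewrite /= -[LHS]/(fine (gauss_cdf x)%:E) gauss_cdf_prob.
Qed.

Lemma cvg_gauss_cdfNy : gauss_cdf x @[x --> -oo] --> (0 : R).
Proof.
rewrite (_ : gauss_cdf = fine \o cdf idN).
  by have /fine_cvgP[] := cvg_cdfNy0 idN.
by apply/funext => x; rewrite /= -[LHS]/(fine (gauss_cdf x)%:E) gauss_cdf_prob.
Qed.

(* [z ^+ 2 * expR (- z ^+ 2 / 4) <= 4] controls every moment up to the fourth *)
Lemma gauss_pdf_moment_bound :
  exists2 B : R, 0 < B & forall x, (1 + `|x|) ^+ 3 * gauss_pdf x <= B.
Proof.
have pk0 : 0 < normal_peak (1 : R) by rewrite normal_peak_gt0 ?oner_eq0.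
exists (normal_peak 1 * 100); first by rewrite mulr_gt0.
move=> x; rewrite gauss_pdfE mulrCA; apply: ler_wpM2l; first exact: ltW.
have [E [E0 E1 EE xE]] : exists E, [/\ 0 <= E, E <= 1,
   expR (- (x ^+ 2 / 2)) = E ^+ 2 & x ^+ 2 * E <= 4 ].
  exists (expR (- (x ^+ 2 / 4))); split.
  - exact: expR_ge0.
  - by rewrite -expR0 ler_expR oppr_le0 divr_ge0// sqr_ge0.
  - by rewrite -expRM_natl; congr expR; field.
  - have := expR_ge1Dx (x ^+ 2 / 4).
    rewrite expRN ler_pdivrMr ?expR_gt0//; lra.
rewrite -(real_normK (num_real x)) in xE; rewrite {}EE.
have : 0 <= `|x| by []; move: `|x| xE => a aE a0.
have h1 : (1 + a) ^+ 3 <= 8 + 4 * a ^+ 4.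
  have := sqr_ge0 (a - 1); have := sqr_ge0 (a * (a - 1)).
  have := sqr_ge0 (a ^+ 2 - 1); lra.
have h2 : (a ^+ 2 * E) ^+ 2 <= 16.
  by rewrite (_ : 16 = 4 ^+ 2 :> R) ?lerXn2r ?nnegrE ?mulr_ge0 ?sqr_ge0//; lra.
have h3 : E ^+ 2 <= 1 by rewrite expr_le1.
apply: (@le_trans _ _ ((8 + 4 * a ^+ 4) * E ^+ 2)).
  by rewrite ler_wpM2r// sqr_ge0.
rewrite (_ : _ * _ = 8 * E ^+ 2 + 4 * (a ^+ 2 * E) ^+ 2); last by ring.
lra.
Qed.

End gaussian_cdf.

(** * Derivatives and expansion of the heat flow *)

Section heat_flow.
Context {R : realType}.
Implicit Types s u x z : R.

(* [heat 0 s] is the solution at time s of the heat equation with initial datum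
   the Heaviside function; [heat k s] is its k-th space derivative. *)
Definition heat (k : nat) s u : R :=
  let z := u / Num.sqrt s in
  match k with
  | 0 => gauss_cdf z
  | 1 => gauss_pdf z / Num.sqrt s
  | _ => - z * gauss_pdf z / s
  end.

(** Third space derivative; it makes [heat 2] Lipschitz in space. *)
Let heat3 s u : R :=
  let z := u / Num.sqrt s in (z ^+ 2 - 1) * gauss_pdf z / (s * Num.sqrt s).

(** Time derivative of [heat 2]; it makes [heat 2] Lipschitz in time. *)
Let dheat2 s u : R :=
  let z := u / Num.sqrt s in (z * (3 - z ^+ 2) / 2) * gauss_pdf z / s ^+ 2.

Lemma is_derive_heat0 s u : 0 < s -> is_derive u 1 (heat 0 s) (heat 1 s u).
Proof.
move=> s0; have r0 : Num.sqrt s != 0 by rewrite gt_eqF// sqrtr_gt0.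
have d1 := is_derive_gauss_cdf (u / Num.sqrt s).
have d2 : is_derive u 1 (fun u => u / Num.sqrt s) (Num.sqrt s)^-1.
  by apply: is_derive_eq; rewrite /GRing.scale /=; field.
exact: (@is_derive1_comp _ gauss_cdf (fun u => u / Num.sqrt s) _ _ _ d1 d2).
Qed.

Lemma is_derive_heat1 s u : 0 < s -> is_derive u 1 (heat 1 s) (heat 2 s u).
Proof.
move=> s0; have r0 : Num.sqrt s != 0 by rewrite gt_eqF// sqrtr_gt0.
have d1 := is_derive_gauss_pdf (u / Num.sqrt s).
have d2 : is_derive u 1 (fun u => u / Num.sqrt s) (Num.sqrt s)^-1.
  by apply: is_derive_eq; rewrite /GRing.scale /=; field.
have d3 := @is_derive1_comp _ gauss_pdf (fun u => u / Num.sqrt s) _ _ _ d1 d2.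
have -> : heat 1 s = fun u => (Num.sqrt s)^-1 *: (gauss_pdf \o (fun u => u / Num.sqrt s)) u.
  by apply/funext => v; rewrite /heat /= /GRing.scale /= mulrC.
apply: is_derive_eq; rewrite /heat /GRing.scale /=.
(* With [s] written as [r ^+ 2] the identity is rational in [r]. *)
move: r0 (sqr_sqrtr (ltW s0)); set r := Num.sqrt s => r0 <-.
by field.
Qed.

Let is_derive_heat2 s u : 0 < s -> is_derive u 1 (heat 2 s) (heat3 s u).
Proof.
move=> s0; have r0 : Num.sqrt s != 0 by rewrite gt_eqF// sqrtr_gt0.
have d1 := is_derive_gauss_pdf (u / Num.sqrt s).
have d2 : is_derive u 1 (fun u => u / Num.sqrt s) (Num.sqrt s)^-1.
  by apply: is_derive_eq; rewrite /GRing.scale /=; field.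
have d3 := @is_derive1_comp _ gauss_pdf (fun u => u / Num.sqrt s) _ _ _ d1 d2.
have -> : heat 2 s = fun u => (- (u / Num.sqrt s) / s) *
    (gauss_pdf \o (fun u => u / Num.sqrt s)) u.
  by apply/funext => v; rewrite /heat /=; ring.
apply: is_derive_eq; rewrite /heat3 /GRing.scale /=.
move: r0 (sqr_sqrtr (ltW s0)); set r := Num.sqrt s => r0 <-.
by field.
Qed.

Let is_derive_rescale s u : 0 < s ->
  is_derive s 1 (fun s => u / Num.sqrt s) (- (u / Num.sqrt s) / (2 * s)).
Proof.
move=> s0; have r0 : Num.sqrt s != 0 by rewrite gt_eqF// sqrtr_gt0.
have d1 := is_derive1_sqrt s0.
have d2 := is_deriveV r0 d1.
apply: is_derive_eq; rewrite /GRing.scale /=.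
move: r0 (sqr_sqrtr (ltW s0)); set r := Num.sqrt s => r0 <-.
by field.
Qed.

(** The heat equation: it is why the time spent in one step cancels the mean of the squared
    increment. *)
Lemma is_derive_heat0_time s u : 0 < s ->
  is_derive s 1 (heat 0 ^~ u) (2^-1 * heat 2 s u).
Proof.
move=> s0; have r0 : Num.sqrt s != 0 by rewrite gt_eqF// sqrtr_gt0.
have d1 := is_derive_gauss_cdf (u / Num.sqrt s).
have d2 := @is_derive1_comp _ gauss_cdf (fun s => u / Num.sqrt s) _ _ _ d1
  (is_derive_rescale u s0).
apply: (is_derive_eq d2); rewrite /heat.
have s1 : s != 0 by rewrite gt_eqF.
by field; rewrite s1.
Qed.

Let is_derive_heat2_time s u : 0 < s ->
  is_derive s 1 (heat 2 ^~ u) (dheat2 s u).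
Proof.
move=> s0; have r0 : Num.sqrt s != 0 by rewrite gt_eqF// sqrtr_gt0.
have d0 := is_derive_rescale u s0.
have d1 := is_derive_gauss_pdf (u / Num.sqrt s).
have d3 := @is_derive1_comp _ gauss_pdf (fun s => u / Num.sqrt s) _ _ _ d1 d0.
have s1 : s != 0 by rewrite gt_eqF.
have d4 := is_deriveV s1 (is_derive_id s (1 : R)).
have -> : heat 2 ^~ u = fun s => (- (u / Num.sqrt s) * s^-1) *
    (gauss_pdf \o (fun s => u / Num.sqrt s)) s.
  by apply/funext => v; rewrite /heat /=; ring.
apply: is_derive_eq; rewrite /dheat2 /GRing.scale /=.
by field; rewrite s1 r0.
Qed.

Lemma heat0_ge0 s u : 0 <= heat 0 s u.
Proof. exact: gauss_cdf_ge0. Qed.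

Lemma heat0_le1 s u : heat 0 s u <= 1.
Proof. exact: gauss_cdf_le1. Qed.

Lemma measurable_heat k s : measurable_fun setT (heat k s).
Proof.
have m1 : measurable_fun setT (fun u : R => u / Num.sqrt s).
  exact: measurable_funM.
have m2 : measurable_fun setT (fun u : R => gauss_pdf (u / Num.sqrt s)).
  by apply: measurableT_comp => //; exact: measurable_gauss_pdf.
case: k => [|[|k]] /=.
- by apply: measurableT_comp => //; exact: measurable_gauss_cdf.
- exact: measurable_funM.
- by apply: measurable_funM => //; apply: measurable_funM => //; exact: measurableT_comp.
Qed.

(** Apart from [heat 0], which is at most 1, each function is a polynomial of degree at most 3 in
    [z], times [gauss_pdf z], times a negative power of [Num.sqrt s]. The moment bound controls the
    first two factors, [eps <= s] the last. *)
Lemma heat_bounds (eps : R) : 0 < eps -> exists2 K : R, 1 <= K & forall s u, eps <= s ->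
  [/\ `|heat 0 s u| <= K, `|heat 1 s u| <= K, `|heat 2 s u| <= K,
      `|heat3 s u| <= K & `|dheat2 s u| <= K].
Proof.
move=> e0; have [B B0 hB] := @gauss_pdf_moment_bound R.
have r0 : 0 < Num.sqrt eps by rewrite sqrtr_gt0.
(* [q] dominates 1, [s^-1] and [(Num.sqrt s)^-1]; at most three such factors occur, whence
   [q ^+ 3]. *)
pose q := 1 + eps^-1 + (Num.sqrt eps)^-1.
have q1 : 1 <= q by rewrite /q -addrA lerDl addr_ge0// invr_ge0 ltW.
exists (1 + 2 * B * q ^+ 3) => [|s u es].
  by rewrite lerDl !mulr_ge0 ?ltW ?exprn_gt0// (lt_le_trans _ q1).
have s0 : 0 < s by exact: lt_le_trans es.
have rs0 : 0 < Num.sqrt s by rewrite sqrtr_gt0.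
have s1 : s^-1 <= q.
  apply: (@le_trans _ _ eps^-1); first by rewrite lef_pV2 ?posrE.
  by rewrite /q addrAC lerDr addr_ge0// invr_ge0 ltW.
have rs1 : (Num.sqrt s)^-1 <= q.
  apply: (@le_trans _ _ (Num.sqrt eps)^-1); last first.
    by rewrite /q lerDr addr_ge0// invr_ge0 ltW.
  by rewrite lef_pV2 ?posrE//; exact: ler_wsqrtr.
have q0 : 0 <= q by exact: le_trans q1.
have main (p y : R) : `|p| <= 2 * (1 + `|u / Num.sqrt s|) ^+ 3 -> 0 <= y -> y <= q ^+ 3 ->
    `|p * gauss_pdf (u / Num.sqrt s) * y| <= 1 + 2 * B * q ^+ 3.
  move=> pz y0 yq; rewrite !normrM (ger0_norm y0) (ger0_norm (gauss_pdf_ge0 _)).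
  apply: (@le_trans _ _ (2 * B * q ^+ 3)); last by rewrite lerDr.
  apply: ler_pM => //; first by rewrite mulr_ge0 ?gauss_pdf_ge0.
  apply: (@le_trans _ _ (2 * (1 + `|u / Num.sqrt s|) ^+ 3 * gauss_pdf (u / Num.sqrt s))).
    by rewrite ler_wpM2r ?gauss_pdf_ge0.
  by rewrite -mulrA ler_wpM2l.
have z0 : 0 <= `|u / Num.sqrt s| by [].
have qs k y : 0 <= y -> y <= q -> (k <= 3)%N -> 0 <= y ^+ k /\ y ^+ k <= q ^+ 3.
  move=> y0 yq k3; split; first exact: exprn_ge0.
  apply: (@le_trans _ _ (q ^+ k)); first by rewrite lerXn2r ?nnegrE.
  exact: ler_weXn2l.
have is0 : 0 <= s^-1 by rewrite invr_ge0 ltW.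
have irs0 : 0 <= (Num.sqrt s)^-1 by rewrite invr_ge0 ltW.
have cube (a : R) : 0 <= a -> [/\ 1 <= (1 + a) ^+ 3, a <= (1 + a) ^+ 3,
    a ^+ 2 <= (1 + a) ^+ 3 & a ^+ 3 <= (1 + a) ^+ 3].
  move=> a0; have a2 := mulr_ge0 a0 a0; have a3 := mulr_ge0 a0 a2.
  by split; lra.
have [c0 c1 c2 c3] := cube _ z0.
set z := u / Num.sqrt s in main z0 c0 c1 c2 c3 *.
split.
- rewrite ger0_norm ?heat0_ge0// (le_trans (heat0_le1 _ _))// lerDl.
  by rewrite !mulr_ge0 ?ltW ?exprn_gt0// (lt_le_trans _ q1).
- rewrite /heat /= -/z -[gauss_pdf z]mul1r; have [y0 yq] := qs 1%N _ irs0 rs1 isT.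
  by apply: main => //; rewrite normr1; lra.
- rewrite /heat /= -/z; have [y0 yq] := qs 1%N _ is0 s1 isT.
  by apply: main => //; rewrite normrN; lra.
- rewrite /heat3 /= -/z; apply: main.
  + by rewrite (le_trans (ler_normB _ _))// normrX normr1; lra.
  + by rewrite invr_ge0 mulr_ge0// ltW.
  + rewrite invfM; apply: (@le_trans _ _ (q * q)); first exact: ler_pM.
    by rewrite -expr2 ler_weXn2l.
- rewrite /dheat2 /= -/z -exprVn; have [y0 yq] := qs 2%N _ is0 s1 isT.
  apply: main => //; rewrite normrM (ger0_norm (_ : 0 <= 2^-1)) ?invr_ge0// normrM.
  have := ler_normB 3 (z ^+ 2); rewrite normrX normr_nat => h.
  have : `|z| * `|3 - z ^+ 2| <= `|z| * (3 + `|z| ^+ 2) by rewrite ler_wpM2l.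
  lra.
Qed.

(** Taylor to order 2 in space at time [s], then to order 1 in time at [u - v]. By the heat equation
    both corrections carry [heat 2], which leaves the combination [v ^+ 2 - h]. With [h] of the
    order of [v ^+ 2] the error is of third order. *)
Lemma heat_expansion (eps : R) : 0 < eps -> exists2 K : R, 1 <= K &
  [/\ forall k s u, (k <= 2)%N -> eps <= s -> `|heat k s u| <= K,
      forall k s u v, (k <= 2)%N -> eps <= s ->
        `|heat k s u - heat k s v| <= K * `|u - v| &
      forall s h u v, eps <= s -> eps <= s - h -> 0 <= h ->
        `|heat 0 (s - h) (u - v) -
          (heat 0 s u - heat 1 s u * v + 2^-1 * heat 2 s u * (v ^+ 2 - h))| <=
        K * (`|v| ^+ 3 + h * `|v| + h ^+ 2)].
Proof.
move=> e0; have [K K1 hK] := heat_bounds e0; exists K => //.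
have K0 : 0 <= K by exact: le_trans K1.
have pos s : eps <= s -> 0 < s by exact: lt_le_trans.
have lip k s u v : (k <= 2)%N -> eps <= s ->
    `|heat k s u - heat k s v| <= K * `|u - v|.
  move=> k2 es; have s0 := pos s es.
  have lip' (f f' : R -> R) : (forall z, is_derive z 1 f (f' z)) ->
      (forall z, `|f' z| <= K) -> `|f u - f v| <= K * `|u - v|.
    move=> df f'K; apply: (@lipschitz_ray _ f f' (Num.min u v)) => //.
      by rewrite ge_min lexx orbT.
    by rewrite ge_min lexx.
  case: k k2 => [|[|[|//]]] _.
  - apply: (lip' _ (heat 1 s)) => z; first exact: is_derive_heat0.
    by have [] := hK s z es.
  - apply: (lip' _ (heat 2 s)) => z; first exact: is_derive_heat1.
    by have [] := hK s z es.
  - apply: (lip' _ (heat3 s)) => z; first exact: is_derive_heat2.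
    by have [] := hK s z es.
split=> [k s u k2 es|//|s h u v es esh h0].
  by have [] := hK s u es; case: k k2 => [|[|[|]]].
have s0 := pos s es.
have space : `|heat 0 s (u - v) - heat 0 s u - heat 1 s u * (u - v - u) -
    2^-1 * heat 2 s u * (u - v - u) ^+ 2| <= K * `|u - v - u| ^+ 3.
  apply: (@taylor2_ray _ (heat 0 s) (heat 1 s) (heat 2 s) (Num.min u (u - v))) => //.
  - by move=> z _; exact: is_derive_heat0.
  - by move=> z _; exact: is_derive_heat1.
  - by move=> x y _ _; exact: lip.
  - by rewrite ge_min lexx.
  - by rewrite ge_min lexx orbT.
have time : `|heat 0 (s - h) (u - v) - heat 0 s (u - v) -
    2^-1 * heat 2 s (u - v) * (s - h - s)| <= K * `|s - h - s| ^+ 2.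
  apply: (@taylor1_ray _ (heat 0 ^~ (u - v)) (fun s => 2^-1 * heat 2 s (u - v)) eps) => //.
  - by move=> z /pos z0; exact: is_derive_heat0_time.
  - move=> x y ex ey; rewrite -mulrBr normrM ger0_norm ?invr_ge0//.
    have l2 := @lipschitz_ray _ (heat 2 ^~ (u - v)) (dheat2 ^~ (u - v)) eps K _ _ x y ex ey.
    apply: le_trans (l2 _ _).
    + by rewrite ler_piMl// invf_le1//; lra.
    + by move=> z /pos z0; exact: is_derive_heat2_time.
    + by move=> z ez; have [] := hK z (u - v) ez.
have := lip 2%N s (u - v) u isT es.
move: space time.
rewrite (_ : u - v - u = - v); last by ring.
rewrite (_ : s - h - s = - h); last by ring.
rewrite !normrN (ger0_norm h0) => space time l2.
(* The time expansion is taken at [u - v]; moving its coefficient to [u] costs the term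
   [h * |v|]. *)
have l2h : `|2^-1 * (heat 2 s (u - v) - heat 2 s u) * h| <= K * (h * `|v|).
  rewrite normrM (ger0_norm h0) normrM (ger0_norm (_ : 0 <= 2^-1)) ?invr_ge0//.
  rewrite [leRHS]mulrCA [leLHS]mulrC ler_wpM2l//.
  apply: le_trans l2; rewrite ler_piMl// invf_le1//; lra.
rewrite (_ : _ - _ = (heat 0 s (u - v) - heat 0 s u - heat 1 s u * - v -
    2^-1 * heat 2 s u * (- v) ^+ 2) + (heat 0 (s - h) (u - v) - heat 0 s (u - v) -
    2^-1 * heat 2 s (u - v) * - h) - 2^-1 * (heat 2 s (u - v) - heat 2 s u) * h);
  last by ring.
apply: le_trans (ler_normB _ _) _.
apply: le_trans (lerD (ler_normD _ _) (lexx _)) _.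
by rewrite !(mulrDr K) [leRHS]addrAC; apply: lerD => //; exact: lerD.
Qed.

End heat_flow.

(** * Expansion of products *)

Section product_bounds.
Context {R : realType} {I : eqType}.
Implicit Types (r : seq I) (K : R).

Lemma norm_prod_le r (a : I -> R) K : (forall l, l \in r -> `|a l| <= K) ->
  `|\prod_(l <- r) a l| <= K ^+ size r.
Proof.
elim: r => [|i r IH] aK; first by rewrite big_nil normr1.
rewrite big_cons normrM exprS ler_pM//; first by rewrite aK ?mem_head.
by apply: IH => l lr; rewrite aK// inE lr orbT.
Qed.

Lemma norm_sum_le r (F : I -> R) K : (forall i, `|F i| <= K) ->
  `|\sum_(i <- r) F i| <= (size r)%:R * K.
Proof.
move=> FK; apply: le_trans (ler_norm_sum _ _ _) _.
rewrite -[X in X%:R]count_predT -sum1_count natr_sum big_distrl /=.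
by apply: ler_sum => i _; rewrite mul1r.
Qed.

(** Factors are exchanged one at a time; [1 <= K] allows the same power of [K] at every position. *)
Lemma lipschitz_prod r (a b : I -> R) K : 1 <= K ->
  (forall l, `|a l| <= K) -> (forall l, `|b l| <= K) ->
  `|\prod_(l <- r) a l - \prod_(l <- r) b l| <=
  K ^+ size r * \sum_(l <- r) `|a l - b l|.
Proof.
move=> K1 aK bK; have K0 : 0 <= K by exact: le_trans K1.
elim: r => [|i r IH]; first by rewrite !big_nil subrr normr0 mulr0.
rewrite !big_cons mulrDr.
rewrite (_ : _ - _ = (a i - b i) * \prod_(l <- r) a l +
  b i * (\prod_(l <- r) a l - \prod_(l <- r) b l)); last by ring.
apply: (le_trans (ler_normD _ _)); apply: lerD.
  rewrite normrM mulrC ler_wpM2r// (@le_trans _ _ (K ^+ size r))//.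
    exact: norm_prod_le.
  by rewrite /= exprS ler_peMl// exprn_ge0.
by rewrite normrM /= exprS -mulrA ler_pM.
Qed.

End product_bounds.

Section product_expansion.
Context {R : realType} {I : eqType}.
(** [d i k] stands for the k-th derivative of the i-th factor at the old point, [f i] for the factor
    at the new point and time, [X i] for the increment, [h] for the elapsed time, [rho] for a common
    size of the increments and of [sqrt h]. *)
Variables (d : I -> nat -> R) (f X : I -> R) (h rho K : R).
Hypotheses (K1 : 1 <= K) (rho0 : 0 <= rho) (h0 : 0 <= h) (h_rho : h <= rho ^+ 2).
Hypothesis X_rho : forall i, `|X i| <= rho.
Hypothesis d_le : forall i k, (k <= 2)%N -> `|d i k| <= K.
Hypothesis f_le : forall i, `|f i| <= K.
Hypothesis f_expansion : forall i,
  `|f i - (d i 0 + d i 1 * X i + 2^-1 * d i 2 * (X i ^+ 2 - h))| <= K * rho ^+ 3.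
Implicit Types r : seq I.

Let D1 r i := \prod_(l <- r) d l (l == i).
Let D2 r i j := \prod_(l <- r) d l ((l == i) + (l == j))%N.
Let P r := \prod_(l <- r) d l 0.
Let L r := \sum_(i <- r) X i * D1 r i.
(** Only the diagonal carries [h]: the generator is half the Laplacian, without mixed
    derivatives. *)
Let Q r := 2^-1 * \sum_(i <- r) \sum_(j <- r)
  (X i * X j - (i == j)%:R * h) * D2 r i j.

Let P_cons a r : P (a :: r) = d a 0 * P r.
Proof. by rewrite /P big_cons. Qed.

Let D1_cons a r i : i \in r -> a \notin r -> D1 (a :: r) i = d a 0 * D1 r i.
Proof.
move=> ir ar; rewrite /D1 big_cons (_ : (a == i) = false)//.
by apply/negP => /eqP ai; rewrite ai ir in ar.
Qed.

Let D1_head a r : a \notin r -> D1 (a :: r) a = d a 1 * P r.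
Proof.
move=> ar; rewrite /D1 big_cons eqxx; congr (_ * _).
apply: eq_big_seq => l lr; rewrite (_ : (l == a) = false)//.
by apply/negP => /eqP la; rewrite -la lr in ar.
Qed.

Let L_cons a r : a \notin r ->
  L (a :: r) = X a * d a 1 * P r + d a 0 * L r.
Proof.
move=> ar; rewrite /L big_cons D1_head// mulrA; congr (_ + _).
rewrite big_distrr /=; apply: eq_big_seq => i ir.
by rewrite D1_cons// mulrCA.
Qed.

(** Leibniz rule for the factor [a], with orders (2, 0), (1, 1) and (0, 2). The mixed order arises
    from both [(a, j)] and [(j, a)], which absorbs the factor [2^-1]. *)
Let Q_cons a r : a \notin r ->
  Q (a :: r) = 2^-1 * d a 2 * (X a ^+ 2 - h) * P r + X a * d a 1 * L r +
    d a 0 * Q r.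
Proof.
move=> ar.
have ne i : i \in r -> (a == i) = false /\ (i == a) = false.
  by move=> ir; split; apply/negP => /eqP e; [rewrite e ir in ar|rewrite -e ir in ar].
rewrite /Q big_cons big_cons eqxx.
have -> : D2 (a :: r) a a = d a 2 * P r.
  rewrite /D2 big_cons eqxx; congr (_ * _); apply: eq_big_seq => l lr.
  by have [_ ->] := ne l lr.
have D2L j : j \in r -> D2 (a :: r) a j = d a 1 * D1 r j.
  move=> jr; rewrite /D2 big_cons eqxx (ne j jr).1 addn0; congr (_ * _).
  by apply: eq_big_seq => l lr; rewrite (ne l lr).2.
have D2C i j : D2 (a :: r) i j = D2 (a :: r) j i.
  by apply: eq_bigr => l _; rewrite addnC.
have S1 : \sum_(j <- r) (X a * X j - (a == j)%:R * h) * D2 (a :: r) a j =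
    X a * d a 1 * L r.
  rewrite /L big_distrr /=; apply: eq_big_seq => j jr.
  by rewrite (ne j jr).1 mul0r subr0 D2L//; ring.
have S2 : \sum_(i <- r) \sum_(j <- a :: r)
      (X i * X j - (i == j)%:R * h) * D2 (a :: r) i j = X a * d a 1 * L r +
    d a 0 * \sum_(i <- r) \sum_(j <- r) (X i * X j - (i == j)%:R * h) * D2 r i j;
  last by rewrite S1 S2 mul1r; field.
under eq_bigr do rewrite big_cons.
rewrite big_split /=; congr (_ + _).
  rewrite /L big_distrr /=; apply: eq_big_seq => j jr.
  by rewrite (ne j jr).2 mul0r subr0 D2C D2L//; ring.
rewrite big_distrr; apply: eq_big_seq => i ir /=.
rewrite big_distrr; apply: eq_big_seq => j jr /=.
by rewrite /D2 big_cons (ne i ir).1 (ne j jr).1 mulrCA.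
Qed.

Let K0 : 0 <= K. Proof. exact: le_trans K1. Qed.

Let P_le r : `|P r| <= K ^+ size r.
Proof. by apply: norm_prod_le => l _; exact: d_le. Qed.

Let L_le r : `|L r| <= (size r)%:R * (rho * K ^+ size r).
Proof.
apply: norm_sum_le => i; rewrite normrM ler_pM//.
by apply: norm_prod_le => l _; apply: d_le; case: (l == i).
Qed.

Let Q_le r : `|Q r| <= (size r)%:R * ((size r)%:R * (rho ^+ 2 * K ^+ size r)).
Proof.
rewrite /Q normrM ger0_norm ?invr_ge0//.
apply: (@le_trans _ _ (2^-1 * ((size r)%:R * ((size r)%:R * (2 * rho ^+ 2 * K ^+ size r))))).
  rewrite ler_wpM2l ?invr_ge0//.
  apply: norm_sum_le => i; apply: norm_sum_le => j; rewrite normrM ler_pM//; last first.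
    by apply: norm_prod_le => l _; apply: d_le; case: (l == i); case: (l == j).
  apply: (le_trans (ler_normB _ _)).
  rewrite (_ : 2 * _ = rho ^+ 2 + rho ^+ 2); last by ring.
  apply: lerD; first by rewrite normrM expr2 ler_pM.
  rewrite normrM (ger0_norm h0); case: (i == j); rewrite ?normr1 ?normr0 ?mul1r//.
  by rewrite mul0r sqr_ge0.
by rewrite le_eqVlt; apply/orP; left; apply/eqP; field.
Qed.

(** One more factor multiplies the former remainder by [M] and adds 6 terms: three from the
    remainder of the new factor against [P], [L], [Q], and three products of total order at least
    3. *)
Fixpoint expansion_constant (M : R) (n : nat) : R :=
  if n is k.+1 then
    M * expansion_constant M k + 6 * M * ((1 + k%:R + k%:R * k%:R) * M ^+ k)
  else 1.

(** In the product of the expansions of head and tail, the terms of total order at most 2 make up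
    [P], [L], [Q] of the longer list. The product [D * Q r], of order 4, is brought to order 3 by
    [rho <= 1]. *)
Let small_expansion r : uniq r -> rho <= 1 ->
  `|\prod_(l <- r) f l - (P r + L r + Q r)| <=
  expansion_constant K (size r) * rho ^+ 3.
Proof.
move=> + rho1; elim: r => [_|a r IH /= /andP[ar ur]].
  rewrite /P /L /Q !big_nil mulr0 !addr0 subrr normr0.
  by rewrite mul1r exprn_ge0.
have {}IH := IH ur.
rewrite big_cons P_cons L_cons// Q_cons//.
set F := \prod_(l <- r) f l in IH *.
(* [N] bounds [P r], [L r / rho] and [Q r / rho ^+ 2] at the same time. *)
set N := (1 + _ + _) * _.
have N0 : 0 <= N by rewrite mulr_ge0 ?exprn_ge0 ?addr_ge0 ?mulr_ge0.
have KN : (K ^+ size r <= N) /\ ((size r)%:R * K ^+ size r <= N) /\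
   ((size r)%:R * (size r)%:R * K ^+ size r <= N).
  have e0 : 0 <= K ^+ size r by rewrite exprn_ge0.
  have n0 : 0 <= (size r)%:R :> R by [].
  have ne0 := mulr_ge0 n0 e0; have nne0 := mulr_ge0 n0 ne0.
  by rewrite /N; split; [|split]; lra.
have PN : `|P r| <= N by apply: le_trans (P_le r) KN.1.
have LN : `|L r| <= N * rho.
  by apply: le_trans (L_le r) _; rewrite mulrCA mulrC ler_wpM2r// KN.2.1.
have QN : `|Q r| <= N * rho ^+ 2.
  apply: le_trans (Q_le r) _.
  rewrite (_ : _ * _ = (size r)%:R * (size r)%:R * K ^+ size r * rho ^+ 2).
    by rewrite ler_wpM2r ?sqr_ge0// KN.2.2.
  by ring.
set A := d a 0; set B := X a * d a 1; set D := 2^-1 * d a 2 * (X a ^+ 2 - h).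
pose ra := f a - (A + d a 1 * X a + D); pose Rr := F - (P r + L r + Q r).
rewrite (_ : _ - _ = f a * Rr + ra * (P r + L r + Q r) + (B * Q r + D * L r + D * Q r));
  last by rewrite /ra /Rr /B; ring.
have r1 := exprn_ge0 1 rho0; have r2 := exprn_ge0 2 rho0.
have r3 := exprn_ge0 3 rho0.
have r21 : rho ^+ 2 <= 1 by rewrite expr_le1.
have BK : `|B| <= K * rho by rewrite normrM mulrC ler_pM// d_le.
have DK : `|D| <= K * rho ^+ 2.
  rewrite normrM normrM (ger0_norm (_ : 0 <= 2^-1)) ?invr_ge0//.
  have h1 : `|X a ^+ 2 - h| <= 2 * rho ^+ 2.
    apply: (le_trans (ler_normB _ _)).
    rewrite (_ : 2 * _ = rho ^+ 2 + rho ^+ 2); last by ring.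
    by apply: lerD; rewrite ?(ger0_norm h0)// normrX lerXn2r ?nnegrE.
  rewrite (_ : K * _ = 2^-1 * K * (2 * rho ^+ 2)); last by field.
  by rewrite ler_pM ?mulr_ge0 ?invr_ge0// ler_wpM2l ?invr_ge0// d_le.
have H1 : `|f a * Rr| <= K * (expansion_constant K (size r) * rho ^+ 3).
  by rewrite normrM ler_pM.
have H2 : `|ra * (P r + L r + Q r)| <= K * rho ^+ 3 * (3 * N).
  rewrite normrM ler_pM//; first exact: f_expansion.
  apply: (le_trans (ler_normD _ _)).
  apply: (le_trans (lerD (ler_normD _ _) (lexx _))).
  have : N * rho <= N by rewrite ler_piMr.
  have : N * rho ^+ 2 <= N by rewrite ler_piMr.
  lra.
have H3 : `|B * Q r| <= K * N * rho ^+ 3.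
  rewrite normrM (_ : K * _ * _ = K * rho * (N * rho ^+ 2)); last by ring.
  by rewrite ler_pM.
have H4 : `|D * L r| <= K * N * rho ^+ 3.
  rewrite normrM (_ : K * _ * _ = K * rho ^+ 2 * (N * rho)); last by ring.
  by rewrite ler_pM.
have H5 : `|D * Q r| <= K * N * rho ^+ 3.
  rewrite normrM; apply: (@le_trans _ _ (K * rho ^+ 2 * (N * rho ^+ 2))).
    by rewrite ler_pM.
  rewrite (_ : K * _ * _ = K * N * rho ^+ 3 * rho); last by ring.
  by apply: ler_piMr => //; apply: mulr_ge0 => //; exact: mulr_ge0.
apply: (le_trans (ler_normD _ _)).
apply: (le_trans (lerD (ler_normD _ _) (ler_normD _ _))).
apply: (le_trans (lerD (lexx _) (lerD (ler_normD _ _) (lexx _)))).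
rewrite /= -/N; lra.
Qed.

Let large_expansion r : 1 <= rho ->
  `|\prod_(l <- r) f l - (P r + L r + Q r)| <=
  (2 + (size r)%:R + (size r)%:R * (size r)%:R) * K ^+ size r * rho ^+ 3.
Proof.
move=> rho1; have e0 : 0 <= K ^+ size r by rewrite exprn_ge0.
have n0 : 0 <= (size r)%:R :> R by [].
have fK : `|\prod_(l <- r) f l| <= K ^+ size r by apply: norm_prod_le => l _.
have r2 : rho ^+ 2 <= rho ^+ 3 by rewrite ler_weXn2l.
have r1 : rho <= rho ^+ 3 by rewrite -[leLHS]expr1 ler_weXn2l.
have r0 : 1 <= rho ^+ 3 by rewrite exprn_ege1.
have L' : `|L r| <= (size r)%:R * K ^+ size r * rho ^+ 3.
  apply: le_trans (L_le r) _; rewrite -mulrA ler_wpM2l// mulrC ler_wpM2l//.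
have Q' : `|Q r| <= (size r)%:R * (size r)%:R * K ^+ size r * rho ^+ 3.
  apply: le_trans (Q_le r) _; rewrite -!mulrA; do 2 apply: ler_wpM2l => //.
  by rewrite mulrA -expr2 [leLHS]mulrC; apply: ler_wpM2l.
have P' : K ^+ size r <= K ^+ size r * rho ^+ 3 by rewrite ler_peMr.
apply: (le_trans (ler_normB _ _)).
apply: (le_trans (lerD (lexx _) (ler_normD _ _))).
apply: (le_trans (lerD (lexx _) (lerD (ler_normD _ _) (lexx _)))).
have := P_le r; lra.
Qed.

(* The weights [l == i] and [(l == i) + (l == j)] are the orders of the partial
   derivatives in the l-th variable. *)
Lemma prod_expansion r : uniq r ->
  `|\prod_(l <- r) f l - (\prod_(l <- r) d l 0 +
     \sum_(i <- r) X i * \prod_(l <- r) d l (l == i) +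
     2^-1 * \sum_(i <- r) \sum_(j <- r) (X i * X j - (i == j)%:R * h) *
       \prod_(l <- r) d l ((l == i) + (l == j))%N)| <=
  (expansion_constant K (size r) +
   (2 + (size r)%:R + (size r)%:R * (size r)%:R) * K ^+ size r) * rho ^+ 3.
Proof.
move=> ur; have r3 := exprn_ge0 3 rho0.
have C0 n : 0 <= expansion_constant K n.
  elim: n => [|n IH] //=; apply: addr_ge0; first exact: mulr_ge0.
  apply: mulr_ge0; first exact: mulr_ge0.
  apply: mulr_ge0; last exact: exprn_ge0.
  by rewrite addr_ge0 ?addr_ge0 ?mulr_ge0.
have e0 : 0 <= K ^+ size r by rewrite exprn_ge0.
have n0 : 0 <= (size r)%:R :> R by [].
have [rho1|/ltW rho1] := leP rho 1.
  apply: le_trans (small_expansion ur rho1) _; rewrite ler_wpM2r// lerDl.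
  by rewrite mulr_ge0// !addr_ge0 ?mulr_ge0.
apply: le_trans (large_expansion r rho1) _; rewrite ler_wpM2r// lerDr.
exact: C0.
Qed.

End product_expansion.

(** * Lindeberg's method *)

Lemma prodr_ge1 (R : realType) (s : seq nat) (Q : pred nat) (u : nat -> R) :
  (forall i, 1 <= u i) -> 1 <= \prod_(i <- s | Q i) u i.
Proof.
move=> u1; elim/big_ind : _ => // x y x1 y1.
by rewrite (le_trans x1)// ler_peMr// (le_trans _ x1).
Qed.

Lemma mul_le_prod (R : realType) (a b i j : nat) (u : nat -> R) :
  (forall i, 1 <= u i) -> (a <= i < b)%N -> (a <= j < b)%N -> i != j ->
  u i * u j <= \prod_(a <= l < b) u l.
Proof.
move=> u1 aib ajb ij; have u0 l : 0 <= u l by exact: le_trans (u1 l).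
rewrite (bigD1_seq i)/= ?mem_index_iota ?iota_uniq//.
rewrite ler_wpM2l// -big_filter (bigD1_seq j)/= ?filter_uniq ?iota_uniq//.
  by rewrite ler_peMr ?prodr_ge1.
by rewrite mem_filter eq_sym ij mem_index_iota.
Qed.

Lemma normr_telescope_le (R : realType) (g : nat -> R) (n : nat) (C : R) :
  (forall k, (k < n)%N -> `|g k.+1 - g k| <= C) -> `|g n - g 0| <= n%:R * C.
Proof.
elim: n => [|n IH] gC; first by rewrite subrr normr0 mul0r.
rewrite -(subrKA (g n)) -natr1 mulrDl mul1r addrC.
apply: (le_trans (ler_normD _ _)); apply: lerD; last exact: gC.
by apply: IH => k kn; exact/gC/ltnW.
Qed.

Section lindeberg.
Context d (T : measurableType d) (R : realType) (P : probability T R).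
Variables (Z : nat -> T -> R) (m : nat) (M : R).
Hypothesis mZ : forall i, measurable_fun setT (Z i).
Hypothesis indepZ : independent_seq P Z.
Hypothesis intZ3 : forall i, integrable_rv P (fun w => (1 + `|Z i w|) ^+ 3).
Hypothesis meanZ3 : forall i, mean P (fun w => (1 + `|Z i w|) ^+ 3) = M.
Hypothesis meanZ1 : forall i, mean P (Z i) = 0.
Hypothesis meanZ2 : forall i, mean P (fun w => Z i w ^+ 2) = 1.

(** The lag is [i.+1], at most [m], and the shift by [m] keeps all indices natural. The last
    coordinate is [k + m], so [lag_sum e k] involves only coordinates below [k + m]. *)
Definition lag_product (k : nat) (i : 'I_m) (w : T) : R :=
  Z (k + m)%N w * Z (k + m - i.+1)%N w.

Definition lag_sum (e : R) (k : nat) (i : 'I_m) (w : T) : R :=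
  e * \sum_(0 <= j < k) lag_product j i w.

Let lag_sum0 e i w : lag_sum e 0 i w = 0.
Proof. by rewrite /lag_sum big_geq// mulr0. Qed.

Let intZ i : integrable_rv P (Z i).
Proof.
apply: integrable_rv_le (intZ3 i) _ => // w.
have : 0 <= `|Z i w| by []; move: `|Z i w| => a a0.
have a2 := mulr_ge0 a0 a0; have a3 := mulr_ge0 a0 a2; lra.
Qed.

Let intZ2 i : integrable_rv P (fun w => Z i w ^+ 2).
Proof.
apply: integrable_rv_le (intZ3 i) _ => [|w]; first exact: measurable_funX.
rewrite normrX; have : 0 <= `|Z i w| by []; move: `|Z i w| => a a0.
have a2 := mulr_ge0 a0 a0; have a3 := mulr_ge0 a0 a2; lra.
Qed.

Let covZ a b : integrable_rv P (fun w => Z a w * Z b w) /\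
  mean P (fun w => Z a w * Z b w) = (a == b)%:R.
Proof.
wlog ab : a b / (a <= b)%N => [hw|].
  have [|/ltnW] := leqP a b; first exact: hw.
  move=> /hw[i1 i2]; rewrite eq_sym -i2; split.
    by apply: eq_integrable_rv i1 => w; rewrite mulrC.
  by apply: eq_mean => w; rewrite mulrC.
move: ab; rewrite leq_eqVlt => /predU1P[->|ab]; rewrite ?eqxx.
  by split; [exact: intZ2|exact: meanZ2].
have [|||||i1 i2] := @mean_mul_windows _ _ _ _ _ mZ indepZ 0 b b.+1 (Z a) (Z b).
- by rewrite leqnSn.
- exact: window_measurable_coord.
- by apply: window_measurable_coord; rewrite leqnn/=.
- exact: intZ.
- exact: intZ.
by split=> //; rewrite i2 meanZ1 mul0r ltn_eqF.
Qed.

Let lag_sum_window e k b i : (k + m <= b)%N ->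
  window_measurable Z 0 b (lag_sum e k i).
Proof.
move=> kb; apply: measurable_funM; first exact: measurable_cst.
apply: measurable_sum_nat => j /andP[_ jk].
by apply: measurable_funM; apply: window_measurable_coord; lia.
Qed.

(** Going back [m] steps leaves only coordinates below [k]. For [k < m] the truncated difference is
    0 and the sum is empty. *)
Let lag_sum_window_sub e k i : window_measurable Z 0 k (lag_sum e (k - m) i).
Proof.
have [mk|km] := leqP m k; first by apply: lag_sum_window; lia.
rewrite (_ : lag_sum e _ _ = fun=> e * 0); first exact: measurable_cst.
by apply/funext => w; rewrite /lag_sum big_geq//; lia.
Qed.

(** A common majorant of the lag products numbered [k - m] to [k]: it controls both the increment
    and the freezing error, and is a product of independent factors. *)
Let U k w : R := \prod_((k - m)%N <= l < (k + m).+1) (1 + `|Z l w|).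

Let U1 k w : 1 <= U k w.
Proof. by apply: prodr_ge1 => l; rewrite lerDl. Qed.

Let M1 : 1 <= M.
Proof.
rewrite -(meanZ3 0) -[leLHS](mean_cst P); apply: le_mean => //.
  exact: integrable_rv_cst.
by move=> w; rewrite exprn_ege1// lerDl.
Qed.

Let mean_U3 k : integrable_rv P (fun w => U k w ^+ 3) /\
  mean P (fun w => U k w ^+ 3) <= M ^+ (2 * m).+1.
Proof.
have e w : \prod_((k - m)%N <= l < (k + m).+1) (1 + `|Z l w|) ^+ 3 = U k w ^+ 3.
  by rewrite /U prodrXl.
have [||||i1 i2] := @mean_prod_window _ _ _ _ _ mZ indepZ
  (fun x => (1 + `|x|) ^+ 3) M (k - m) (k + m).+1.
- lia.
- by apply: measurable_funX; apply: measurable_funD => //; exact: measurable_normr.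
- exact: intZ3.
- exact: meanZ3.
split; first exact: eq_integrable_rv e i1.
(* Near the origin the window is cut at 0 and has fewer than [2 * m + 1] coordinates; [1 <= M]
   covers this case. *)
rewrite -(eq_mean _ e) i2 ler_weXn2l//; lia.
Qed.

Let le_U k j (i : 'I_m) w : (k - m <= j <= k)%N -> `|lag_product j i w| <= U k w.
Proof.
move=> kj; have im := ltn_ord i; rewrite /lag_product normrM.
apply: (@le_trans _ _ ((1 + `|Z (j + m)%N w|) * (1 + `|Z (j + m - i.+1)%N w|))).
  by rewrite ler_pM// lerDr.
apply: (@mul_le_prod _ _ _ _ _ (fun l => 1 + `|Z l w|)); rewrite ?lerDl//; try lia.
by move=> l; rewrite lerDl.
Qed.

(** A partial derivative, of order [q l] in the l-th lag sum. Each sum [x] enters as [c l - x],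
    whence the signs. *)
Let heat_prod s (c : 'I_m -> R) e k (q : 'I_m -> nat) w : R :=
  \prod_(l < m) ((-1) ^+ q l * heat (q l) s (c l - lag_sum e k l w)).

Let heat_prod_window s c e k q b : (forall l, window_measurable Z 0 b (lag_sum e k l)) ->
  window_measurable Z 0 b (heat_prod s c e k q).
Proof.
move=> mS; apply: measurable_prod => l _; apply: measurable_funM.
  exact: measurable_cst.
apply: measurableT_comp; first exact: measurable_heat.
by apply: measurable_funB; [exact: measurable_cst|exact: mS].
Qed.

(** The martingale property: the newest coordinate [Z (k + m)] is centered and independent of the
    other factors of [F]. *)
Let mean_gradient s c e k q K i : 0 <= K -> (forall w, `|heat_prod s c e k q w| <= K) ->
  let F w := e * lag_product k i w * heat_prod s c e k q w in
  integrable_rv P F /\ mean P F = 0.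
Proof.
move=> K0 HK F; have im := ltn_ord i.
have mH : window_measurable Z 0 (k + m) (heat_prod s c e k q).
  by apply: heat_prod_window => l; exact: lag_sum_window.
have mZH : window_measurable Z 0 (k + m)
    (fun w => Z (k + m - i.+1)%N w * heat_prod s c e k q w).
  apply: measurable_funM; last exact: mH.
  by apply: window_measurable_coord; lia.
have [|||||i1 i2] := @mean_mul_windows _ _ _ _ _ mZ indepZ 0 (k + m) (k + m).+1
  (fun w => Z (k + m - i.+1)%N w * heat_prod s c e k q w) (Z (k + m)%N).
- by rewrite leqnSn.
- exact: mZH.
- by apply: window_measurable_coord; rewrite leqnn/=.
- apply: (@integrable_rv_le _ _ _ _ _ (fun w => K * `|Z (k + m - i.+1)%N w|)).
  + exact: (window_measurable_measurable mZ mZH).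
  + by apply: integrable_rvZ; exact: integrable_norm (intZ _).
  + by move=> w; rewrite normrM mulrC ler_wpM2r.
- exact: intZ.
have e1 w : e * (Z (k + m - i.+1)%N w * heat_prod s c e k q w * Z (k + m)%N w) = F w.
  by rewrite /F /lag_product; ring.
split; first by apply: eq_integrable_rv e1 _; exact: integrable_rvZ.
by rewrite -(eq_mean _ e1) meanZ// i2 meanZ1 !mulr0.
Qed.

(** Three consecutive windows: the weight lives below [k], the lagged factors in
    [k, ..., k + m - 1], the square at [k + m]. The last two give the mean [(i == j)], and the first
    is independent of the factor so centered. *)
Let mean_hessian s c e k q K i j : 0 <= K ->
  (forall w, `|heat_prod s c e (k - m) q w| <= K) ->
  let F w := (e * lag_product k i w * (e * lag_product k j w) -
    (i == j)%:R * e ^+ 2) * heat_prod s c e (k - m) q w in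
  integrable_rv P F /\ mean P F = 0.
Proof.
move=> K0 HK F; have im := ltn_ord i; have jm := ltn_ord j.
have mH : window_measurable Z 0 k (heat_prod s c e (k - m) q).
  by apply: heat_prod_window => l; exact: lag_sum_window_sub.
have iH : integrable_rv P (heat_prod s c e (k - m) q).
  apply: (integrable_rv_le _ (integrable_rv_cst P K)) => //.
  exact: (window_measurable_measurable mZ mH).
pose V w := Z (k + m - i.+1)%N w * Z (k + m - j.+1)%N w.
have mV : window_measurable Z k (k + m) V.
  by apply: measurable_funM; apply: window_measurable_coord; lia.
have [iV meanV] := covZ (k + m - i.+1) (k + m - j.+1).
have [|||||i1 i2] := @mean_mul_windows _ _ _ _ _ mZ indepZ k (k + m) (k + m).+1
  V (fun w => Z (k + m)%N w ^+ 2).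
- by rewrite leq_addr leqnSn.
- exact: mV.
- by apply: measurable_funX; apply: window_measurable_coord; rewrite leqnn/=.
- exact: iV.
- exact: intZ2.
rewrite meanV meanZ2 mulr1 in i2.
have ijE : ((k + m - i.+1)%N == (k + m - j.+1)%N) = (i == j).
  by rewrite -val_eqE /=; apply/eqP/eqP; lia.
rewrite ijE in i2.
pose D w : R := V w * Z (k + m)%N w ^+ 2 - (i == j)%:R.
have iD : integrable_rv P D.
  by apply: integrable_rvB => //; exact: integrable_rv_cst.
have meanD0 : mean P D = 0.
  by rewrite meanB ?mean_cst ?i2 ?subrr//; exact: integrable_rv_cst.
have [|||||i3 i4] := @mean_mul_windows _ _ _ _ _ mZ indepZ 0 k (k + m).+1
  (heat_prod s c e (k - m) q) D.
- lia.
- exact: mH.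
- apply: measurable_funB; last exact: measurable_cst.
  apply: measurable_funM.
    by apply: measurable_funM; apply: window_measurable_coord; lia.
  by apply: measurable_funX; apply: window_measurable_coord; lia.
- exact: iH.
- exact: iD.
have e1 w : e ^+ 2 * (heat_prod s c e (k - m) q w * D w) = F w.
  by rewrite /F /D /V /lag_product; ring.
split; first by apply: eq_integrable_rv e1 _; exact: integrable_rvZ.
by rewrite -(eq_mean _ e1) meanZ// i4 meanD0 !mulr0.
Qed.

(** The constant is uniform in [e], [s] and [k] because [eps <= s - e ^+ 2] keeps the flow away from
    its singular initial time. *)
Lemma lindeberg_step (eps : R) (c : 'I_m -> R) : 0 < eps ->
  exists2 C : R, 0 <= C & forall e s k, 0 <= e <= 1 -> eps <= s - e ^+ 2 ->
  `|mean P (fun w => \prod_(i < m) heat 0 (s - e ^+ 2) (c i - lag_sum e k.+1 i w)) -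
    mean P (fun w => \prod_(i < m) heat 0 s (c i - lag_sum e k i w))| <= C * e ^+ 3.
Proof.
move=> eps0; have [K K1 [heatK heatL heatE]] := heat_expansion eps0.
have K0 : 0 <= K by exact: le_trans K1.
pose r := index_enum 'I_m.
(* [3 * K] because the error in [heat_expansion] has three terms, each at most [K * rho ^+ 3]. *)
pose C1 := expansion_constant (3 * K) (size r) +
   (2 + (size r)%:R + (size r)%:R * (size r)%:R) * (3 * K) ^+ size r.
pose N : R := (size r)%:R.
(* The freezing error: [N * N] pairs of weight at most [rho ^+ 2] after the factor [2^-1], times the
   Lipschitz bound for a product of [N] factors whose arguments move by at most [m * rho]. *)
pose C2 := N * (N * (K ^+ size r * (N * (K * m%:R)))).
have C12 : 0 <= C1 + C2.
  have C0 n : 0 <= expansion_constant (3 * K) n.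
    elim: n => [|n IH] //=; have K3 : 0 <= 3 * K by exact: mulr_ge0.
    apply: addr_ge0; first exact: mulr_ge0.
    apply: mulr_ge0; first exact: mulr_ge0.
    apply: mulr_ge0; last exact: exprn_ge0.
    by rewrite addr_ge0 ?addr_ge0 ?mulr_ge0.
  apply: addr_ge0; last by rewrite /C2 /N !mulr_ge0// exprn_ge0.
  apply: addr_ge0; first exact: C0.
  by rewrite mulr_ge0 ?exprn_ge0 ?addr_ge0 ?mulr_ge0.
exists ((C1 + C2) * M ^+ (2 * m).+1) => [|e s k /andP[e0 e1] es].
  by rewrite mulr_ge0// exprn_ge0// (le_trans _ M1).
pose dd w i q := (-1) ^+ q * heat q s (c i - lag_sum e k i w).
pose f w i := heat 0 (s - e ^+ 2) (c i - lag_sum e k.+1 i w).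
pose X w i := e * lag_product k i w.
pose rho w := e * U k w.
pose G1 w := \prod_(i <- r) f w i.
pose G0 w := \prod_(i <- r) dd w i 0%N.
(* The part of mean 0, with gradient at [S_k] and second derivatives at [S_(k-m)]. The sum [W0]
   below takes both at [S_k]. *)
pose W w := \sum_(i <- r) X w i * heat_prod s c e k (fun l => l == i) w +
  2^-1 * \sum_(i <- r) \sum_(j <- r) (X w i * X w j - (i == j)%:R * e ^+ 2) *
    heat_prod s c e (k - m) (fun l => (l == i) + (l == j))%N w.
have sE : eps <= s by rewrite (le_trans es)// gerBl sqr_ge0.
have U0 w : 0 <= U k w by exact: le_trans (U1 k w).
have main w : `|G1 w - G0 w - W w| <= (C1 + C2) * e ^+ 3 * U k w ^+ 3.
  pose W0 := \sum_(i <- r) X w i * \prod_(l <- r) dd w l (l == i) +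
    2^-1 * \sum_(i <- r) \sum_(j <- r) (X w i * X w j - (i == j)%:R * e ^+ 2) *
    \prod_(l <- r) dd w l ((l == i) + (l == j))%N.
  have rho0 : 0 <= rho w by exact: mulr_ge0.
  have eU : e <= rho w by rewrite ler_peMr.
  have X_rho i : `|X w i| <= rho w.
    by rewrite normrM (ger0_norm e0) ler_wpM2l// le_U// leq_subr/=.
  have ddK k' i q : (q <= 2)%N ->
      `|(-1) ^+ q * heat q s (c i - lag_sum e k' i w)| <= K.
    by move=> q2; rewrite normrM normrX normrN1 expr1n mul1r heatK.
  have K3 : K <= 3 * K by rewrite ler_peMl// ler1n.
  have e2rho : e ^+ 2 <= rho w ^+ 2 by rewrite lerXn2r ?nnegrE.
  have B1 : `|G1 w - G0 w - W0| <= C1 * rho w ^+ 3.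
    rewrite -addrA -opprD addrA.
    apply: (@prod_expansion _ _ (dd w) (f w) (X w) (e ^+ 2) (rho w) (3 * K)) => //.
    - exact: le_trans K3.
    - exact: sqr_ge0.
    - by move=> i q q2; apply: le_trans K3; exact: ddK.
    - by move=> i; apply: le_trans K3; exact: heatK.
    - move=> i; rewrite /f /dd expr0 !mul1r expr1 sqrrN expr1n mul1r.
      have XE : c i - lag_sum e k.+1 i w = c i - lag_sum e k i w - X w i.
        by rewrite /lag_sum /X big_nat_recr//=; ring.
      rewrite XE; set u := c i - _.
      have := heatE s (e ^+ 2) u (X w i) sE es (sqr_ge0 _).
      rewrite (_ : heat 0 s u - _ + _ = heat 0 s u + - 1 * heat 1 s u * X w i +
        2^-1 * heat 2 s u * (X w i ^+ 2 - e ^+ 2)); last by ring.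
      move=> /le_trans; apply; rewrite -mulrA mulrCA ler_wpM2l//.
      have h1 : `|X w i| ^+ 3 <= rho w ^+ 3 by rewrite lerXn2r ?nnegrE.
      have h2 : e ^+ 2 * `|X w i| <= rho w ^+ 3 by rewrite [leRHS]exprSr ler_pM ?sqr_ge0.
      (* Third order because [e <= 1] and [e <= rho w], the latter from [1 <= U k w]. *)
      have h3 : (e ^+ 2) ^+ 2 <= rho w ^+ 3.
        rewrite -exprM; apply: (@le_trans _ _ (e ^+ 3)).
          by rewrite ler_wiXn2l.
        by rewrite lerXn2r ?nnegrE.
      lra.
    - exact: index_enum_uniq.
  have S_le l : `|lag_sum e k l w - lag_sum e (k - m) l w| <= m%:R * rho w.
    rewrite /lag_sum -mulrBr (big_cat_nat (leq0n _) (leq_subr m k))/= addrAC subrr add0r.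
    rewrite normrM (ger0_norm e0) mulrCA ler_wpM2l// big_nat big_mkcond.
    apply: le_trans (norm_sum_le (K := U k w) _ _) _.
      move=> j; case: ifP => [/andP[j1 j2]|_]; last by rewrite normr0.
      by apply: le_U; rewrite j1 ltnW.
    by rewrite ler_wpM2r// size_iota ler_nat leq_subLR addnC -leq_subLR.
  have H_le q : (forall l, (q l <= 2)%N) ->
     `|\prod_(l <- r) dd w l (q l) - heat_prod s c e (k - m) q w| <=
     K ^+ size r * (N * (K * (m%:R * rho w))).
    move=> q2; have := @lipschitz_prod _ _ r (fun l => dd w l (q l))
      (fun l => (-1) ^+ q l * heat (q l) s (c l - lag_sum e (k - m) l w)) K K1.
    move=> /(_ (fun l => ddK _ l _ (q2 l)) (fun l => ddK _ l _ (q2 l))) /le_trans; apply.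
      rewrite ler_wpM2l ?exprn_ge0//.
      rewrite -[leLHS]ger0_norm ?sumr_ge0//; apply: norm_sum_le => l.
      rewrite normr_id -mulrBr normrM normrX normrN1 expr1n mul1r.
      apply: le_trans (heatL _ _ _ _ (q2 l) sE) _; rewrite ler_wpM2l//.
      rewrite distrC (_ : _ - _ = lag_sum e k l w - lag_sum e (k - m) l w).
        exact: S_le.
      by ring.
  have B2 : `|W0 - W w| <= C2 * rho w ^+ 3.
    rewrite /W0 /W; rewrite (_ : forall x y z : R, x + y - (x + z) = y - z); last first.
      by move=> x y z; ring.
    rewrite -mulrBr normrM ger0_norm ?invr_ge0// -sumrB.
    under eq_bigr do rewrite -sumrB.
    have b : `|\sum_(i <- r) \sum_(j <- r)
      ((X w i * X w j - (i == j)%:R * e ^+ 2) *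
        \prod_(l <- r) dd w l ((l == i) + (l == j))%N -
      (X w i * X w j - (i == j)%:R * e ^+ 2) *
        heat_prod s c e (k - m) (fun l => (l == i) + (l == j))%N w)| <=
      N * (N * (2 * rho w ^+ 2 * (K ^+ size r * (N * (K * (m%:R * rho w)))))).
      apply: norm_sum_le => i; apply: norm_sum_le => j.
      rewrite -mulrBr normrM ler_pM//; last first.
        by apply: H_le => l; case: (l == i); case: (l == j).
      apply: (le_trans (ler_normB _ _)).
      rewrite (_ : 2 * _ = rho w ^+ 2 + rho w ^+ 2); last by ring.
      apply: lerD; first by rewrite normrM expr2 ler_pM.
      rewrite normrM (ger0_norm (sqr_ge0 _)); case: (i == j).
        by rewrite normr1 mul1r.
      by rewrite normr0 mul0r sqr_ge0.
    apply: le_trans (ler_wpM2l _ b) _; first by rewrite invr_ge0.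
    have q (x y z t : R) : 2^-1 * (z * (z * (2 * y ^+ 2 * (x * (z * (K * (t * y))))))) =
      z * (z * (x * (z * (K * t)))) * y ^+ 3 by field.
    by rewrite q; exact: lexx.
  rewrite (_ : _ - _ = (G1 w - G0 w - W0) + (W0 - W w)); last by ring.
  apply: (le_trans (ler_normD _ _)); apply: (le_trans (lerD B1 B2)).
  by rewrite -mulrDl /rho exprMn mulrA.
have heat_prodK k' q : (forall l, (q l <= 2)%N) -> 
    forall w, `|heat_prod s c e k' q w| <= K ^+ size r.
  move=> q2 w; apply: norm_prod_le => l _.
  by rewrite normrM normrX normrN1 expr1n mul1r heatK.
have KK : 0 <= K ^+ size r by exact: exprn_ge0.
have [iW meanW] : integrable_rv P W /\ mean P W = 0.
  have q1 i l : (((l : 'I_m) == i) <= 2)%N by case: (l == i).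
  have q2 i j l : (((l : 'I_m) == i) + (l == j) <= 2)%N by case: (l == i); case: (l == j).
  have g i := @mean_gradient s c e k (fun l => l == i) _ i KK (heat_prodK _ _ (q1 i)).
  have h i j := @mean_hessian s c e k (fun l => (l == i) + (l == j))%N _ i j KK
     (heat_prodK _ _ (q2 i j)).
  have s1 := @integrable_rv_sum _ _ _ P _ r xpredT _ (fun i _ => (g i).1).
  have s2 i := @integrable_rv_sum _ _ _ P _ r xpredT _ (fun j _ => (h i j).1).
  have s3 := @integrable_rv_sum _ _ _ P _ r xpredT _ (fun i _ => s2 i).
  have s4 := integrable_rvZ 2^-1 s3.
  split; first exact: integrable_rvD s1 s4.
  rewrite (meanD s1 s4) (meanZ _ s3) (mean_sum r (fun i _ => (g i).1)).
  rewrite (mean_sum r (fun i _ => s2 i)) !big1 ?mulr0 ?addr0// => i _.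
    by rewrite (mean_sum r (fun j _ => (h i j).1)) big1// => j _; exact: (h i j).2.
  exact: (g i).2.
have [iU meanU] := mean_U3 k.
have mS k' l : measurable_fun setT (lag_sum e k' l).
  by apply: (window_measurable_measurable mZ); exact: lag_sum_window.
have iG s' k' : integrable_rv P
    (fun w => \prod_(i <- r) heat 0 s' (c i - lag_sum e k' i w)).
  apply: (integrable_rv_le _ (integrable_rv_cst P 1)) => [|w].
    apply: measurable_prod => l _; apply: measurableT_comp; first exact: measurable_heat.
    exact: measurable_funB.
  apply: le_trans (norm_prod_le (K := 1) _) _ => [l _|]; last by rewrite expr1n.
  by rewrite ger0_norm ?heat0_ge0// heat0_le1.
have iG1 : integrable_rv P G1 by exact: iG.
have G0E w : \prod_(i <- r) heat 0 s (c i - lag_sum e k i w) = G0 w.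
  by apply: eq_bigr => i _; rewrite /dd expr0 mul1r.
have iG0 : integrable_rv P G0 by apply: eq_integrable_rv G0E _; exact: iG.
have i3 := integrable_rvB (integrable_rvB iG1 iG0) iW.
rewrite (eq_mean _ G0E) -[X in `|X - _|]/(mean P G1).
have -> : mean P G1 - mean P G0 = mean P (fun w => G1 w - G0 w - W w).
  by rewrite (meanB (integrable_rvB iG1 iG0) iW) (meanB iG1 iG0) meanW subr0.
apply: (le_trans (le_normr_mean (integrable_rv_measurable i3)
  (integrable_rvZ ((C1 + C2) * e ^+ 3) iU) main)).
rewrite meanZ// [leRHS]mulrAC; apply: ler_wpM2l => //.
by apply: mulr_ge0 => //; exact: exprn_ge0.
Qed.

(** Telescoping along the flow: after [k] terms the remaining time is [1 + eps - k / n]. At [k = 0]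
    the sums vanish and the mean is deterministic. The [n] steps of size [C * e ^+ 3] add up to
    [C * e], as [n * e ^+ 2 = 1]. *)
Theorem lindeberg (eps : R) (c : 'I_m -> R) : 0 < eps ->
  exists2 C : R, 0 <= C & forall n, (0 < n)%N ->
  `|mean P (fun w => \prod_(i < m) heat 0 eps
      (c i - lag_sum (Num.sqrt n%:R)^-1 n i w)) -
    \prod_(i < m) heat 0 (1 + eps) (c i)| <= C * (Num.sqrt n%:R)^-1.
Proof.
move=> eps0; have [C C0 step] := lindeberg_step c eps0.
exists C => // n n0; set e := (Num.sqrt _)^-1.
have nn0 : (0 : R) < n%:R by rewrite ltr0n.
have e2 : n%:R * e ^+ 2 = 1.
  by rewrite /e exprVn sqr_sqrtr ?ler0n// divff// gt_eqF.
have e0 : 0 <= e by rewrite invr_ge0.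
have e1 : e <= 1.
  rewrite -(@expr_le1 _ 2)// -e2 ler_peMl ?sqr_ge0//.
  by rewrite ler1n.
pose g k := mean P (fun w => \prod_(i < m) heat 0 (1 + eps - k%:R * e ^+ 2)
  (c i - lag_sum e k i w)).
have g_n : g n = mean P (fun w => \prod_(i < m) heat 0 eps (c i - lag_sum e n i w)).
  by rewrite /g e2 addrAC subrr add0r.
have g_0 : g 0 = \prod_(i < m) heat 0 (1 + eps) (c i).
  have v0 : 1 + eps - 0%:R * e ^+ 2 = 1 + eps by ring.
  have S0 i w : c i - lag_sum e 0 i w = c i.
    by rewrite lag_sum0 subr0.
  rewrite /g v0 -[RHS](mean_cst P); apply: eq_mean => w.
  by apply: eq_bigr => i _; rewrite S0.
rewrite -g_n -g_0.
have step_le k : (k < n)%N -> `|g k.+1 - g k| <= C * e ^+ 3.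
  move=> kn; have sE : 1 + eps - k%:R * e ^+ 2 - e ^+ 2 = 1 + eps - k.+1%:R * e ^+ 2.
    by rewrite -[k.+1%:R]natr1; ring.
  have ke : k.+1%:R * e ^+ 2 <= 1.
    by rewrite -[leRHS]e2; apply: ler_wpM2r; [exact: sqr_ge0|rewrite ler_nat].
  have := step e (1 + eps - k%:R * e ^+ 2) k; rewrite e0 e1 sE => /(_ isT); apply.
  by rewrite addrAC lerDr subr_ge0.
apply: le_trans (normr_telescope_le step_le) _.
have -> : n%:R * (C * e ^+ 3) = C * (n%:R * e ^+ 2) * e by ring.
by rewrite e2 mulr1.
Qed.

End lindeberg.

(** * The standard normal law in dimension n *)

Section standard_normal_cdf.
Context {R : realType}.
Local Notation RB := (measurableTypeR R).
Local Notation mu := (@lebesgue_measure R).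

Lemma measurable_prod_tnth n (g : nat -> RB -> R) :
  (forall i, measurable_fun setT (g i)) ->
  measurable_fun setT (fun t : n.-tuple RB => \prod_(i < n) g i (tnth t i)).
Proof.
move=> mg; apply: measurable_prod => i _.
by apply: measurableT_comp; [exact: mg|exact: measurable_tnth].
Qed.

(** Tonelli along the recursive construction of [lebesgue_tuple]. The functions are indexed by [nat]
    so that dropping the first one leaves a family of the same kind. *)
Lemma integral_lebesgue_tuple_prod n (g : nat -> RB -> R) :
  (forall i, measurable_fun setT (g i)) -> (forall i x, 0 <= g i x) ->
  (\int[lebesgue_tuple n]_t (\prod_(i < n) g i (tnth t i))%:E =
   \prod_(i < n) \int[mu]_x (g i x)%:E)%E.
Proof.
elim: n g => [|n IH] g mg g0.
  rewrite /= big_ord0 integral_dirac//=.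
    by rewrite diracT mul1e big_ord0.
  by under eq_fun do rewrite big_ord0; exact: measurable_cst.
pose f (t : n.+1.-tuple RB) : \bar R := (\prod_(i < n.+1) g i (tnth t i))%:E.
have mf : measurable_fun setT f.
  by apply/measurable_EFinP; exact: measurable_prod_tnth.
have f0 t : (0 <= f t)%E by rewrite lee_fin prodr_ge0.
have fE x t : f (tuple_cons (x, t)) =
    ((g 0%N x)%:E * (\prod_(i < n) g i.+1 (tnth t i))%:E)%E.
  rewrite /f big_ord_recl -EFinM; congr (_ * _)%:E; apply: eq_bigr => i _.
  by rewrite /tuple_cons (tnth_nth 0) [in RHS](tnth_nth 0).
have mg0 : measurable_fun setT (fun x : RB => (g 0%N x)%:E) by exact/measurable_EFinP.
transitivity (\int[(mu \x lebesgue_tuple n)%E]_p f (tuple_cons p))%E.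
  by apply: (etrans (ge0_integral_pushforward (@measurable_tuple_cons R n) _ _ mf _)).
rewrite fubini_tonelli1//; last exact: (measurableT_comp mf (@measurable_tuple_cons R n)).
rewrite /fubini_F big_ord_recl /=.
under eq_integral => x _.
  under eq_integral do rewrite fE.
  rewrite ge0_integralZl ?lee_fin//; last 2 first.
  - by apply/measurable_EFinP; apply: (@measurable_prod_tnth n (fun i => g i.+1)).
  - by move=> t _; rewrite lee_fin prodr_ge0.
  rewrite (IH (fun i => g i.+1))//.
  over.
rewrite ge0_integralZr//; first by move=> x _; rewrite lee_fin.
by apply: prode_ge0 => i _; apply: integral_ge0 => x _; rewrite lee_fin.
Qed.

Lemma std_normal_pdf_prod n (t : n.-tuple RB) :
  mvnormal_pdf 0 1%:M (row_of_tuple t) = \prod_(i < n) gauss_pdf (tnth t i).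
Proof.
under eq_bigr do rewrite gauss_pdfE.
rewrite big_split /= prodr_const card_ord -expR_sum /mvnormal_pdf; congr (_ * expR _).
  rewrite det1 mulr1 /normal_peak expr1n mul1r -[pi *+ 2]mulr_natl exprVn; congr (_ ^-1).
  have p0 : 0 <= 2 * pi :> R by rewrite mulr_ge0 ?pi_ge0.
  elim: n {t} => [|n IH]; first by rewrite !expr0 sqrtr1.
  by rewrite !exprS sqrtrM// IH.
rewrite subr0 invmx1 mulmx1 mxE mulNr big_distrl /= sumrN; congr (- _).
by apply: eq_bigr => i _; rewrite !mxE expr2.
Qed.

Lemma joint_cdf_std_normal n (x : 'rV[R]_n) :
  joint_cdf (mvnormal 0 1%:M) x = (\prod_(i < n) gauss_cdf (x 0 i))%:E.
Proof.
rewrite /joint_cdf /mvnormal integral_mkcond.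
(* The coordinates of [x] are extended by 0, since the factors [g] are indexed by all naturals. The
   indicator of the orthant is then a product of indicators. *)
pose xx (k : nat) : R := if insub k is Some i then x 0 i else 0.
have xxE (i : 'I_n) : xx i = x 0 i by rewrite /xx valK.
pose g k (y : RB) : R := gauss_pdf y * \1_`]-oo, xx k] y.
have mg k : measurable_fun setT (g k).
  by apply: measurable_funM; [exact: measurable_gauss_pdf|exact: measurable_indic].
have g0 k y : 0 <= g k y by rewrite mulr_ge0 ?gauss_pdf_ge0.
transitivity (\int[lebesgue_tuple n]_t (\prod_(i < n) g i (tnth t i))%:E)%E.
  apply: eq_integral => t _; rewrite patchE std_normal_pdf_prod big_split /=.
  case: ifPn => [|].
    rewrite inE /= => tx; rewrite [X in _ * X]big1 ?mulr1// => i _.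
    by rewrite indicE mem_set//= in_itv /= xxE; have := tx i; rewrite mxE.
  rewrite notin_setE /= => /existsNP[i xt].
  rewrite [X in _ * X](bigD1 i)//= indicE memNset ?mul0r ?mulr0//.
  by rewrite /= in_itv /= xxE; move: xt; rewrite mxE.
rewrite integral_lebesgue_tuple_prod// -prodEFin; apply: eq_bigr => i _.
rewrite /gauss_cdf /Rintegral fineK; last first.
  apply: integrable_fin_num => //.
  by apply: (integrableS _ _ (subsetT _)) => //; exact: integrable_normal_pdf.
rewrite [RHS]integral_mkcond; apply: eq_integral => y _.
rewrite patchE /g indicE -xxE; case: ifP => _ /=; first by rewrite mulr1.
by rewrite mulr0.
Qed.

End standard_normal_cdf.

(** * Sample autocorrelations *)

Section sample_autocovariance.
Context {R : realType}.
Implicit Types (n h : nat) (x y : int -> R) (u v : nat -> R).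

Lemma sample_mean_affine n y (b s : R) : (0 < n)%N ->
  sample_mean n (fun t => b + s * y t) = b + s * sample_mean n y.
Proof.
move=> n0; rewrite /sample_mean big_split /= sumr_const_nat subSS subn0 -big_distrr /=.
have nn0 : n%:R != 0 :> R by rewrite pnatr_eq0 -lt0n.
by rewrite -[b *+ n]mulr_natl; field.
Qed.

Lemma sample_autocov_affine n y (b s : R) h : (0 < n)%N ->
  sample_autocov n (fun t => b + s * y t) h = s ^+ 2 * sample_autocov n y h.
Proof.
move=> n0; rewrite /sample_autocov sample_mean_affine// [RHS]mulrCA; congr (_ * _).
by rewrite mulr_sumr; apply: eq_bigr => t _; ring.
Qed.

Lemma sample_autocorr_affine n y (b s : R) h : (0 < n)%N -> s != 0 ->
  sample_autocorr n (fun t => b + s * y t) h = sample_autocorr n y h.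
Proof.
move=> n0 s0; rewrite /sample_autocorr !sample_autocov_affine// invfM mulrACA.
by rewrite divff ?mul1r// expf_neq0.
Qed.

(** Meant for [u t = y_t] and [v t = y_(t-h)]. The first sum accounts for the [h] products missing
    from the sample covariance, the rest for the centering. Squares are used throughout so that
    means follow from second moments. *)
Lemma lag_covariance_error n h u v : (0 < n)%N -> (h <= n)%N ->
  let e := (Num.sqrt n%:R)^-1 in
  let ub := n%:R^-1 * \sum_(1 <= t < n.+1) u t in
  `|Num.sqrt n%:R * (n%:R^-1 * \sum_(1 + h <= t < n.+1) (u t - ub) * (v t - ub)) -
    e * \sum_(1 <= t < n.+1) u t * v t| <=
  e * (\sum_(1 <= t < h.+1) (u t ^+ 2 + v t ^+ 2) +
    e ^+ 2 * (2 * (\sum_(1 <= t < n.+1) u t) ^+ 2 +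
      (\sum_(1 + h <= t < n.+1) u t) ^+ 2 + (\sum_(1 + h <= t < n.+1) v t) ^+ 2)).
Proof.
move=> n0 hn; cbv zeta; set e := (Num.sqrt _)^-1.
set ub := n%:R^-1 * \sum_(1 <= t < n.+1) u t.
have r0 : 0 < Num.sqrt n%:R :> R by rewrite sqrtr_gt0 ltr0n.
have e0 : 0 < e by rewrite invr_gt0.
have nE : n%:R^-1 = e ^+ 2 by rewrite /e exprVn sqr_sqrtr.
have rE : Num.sqrt n%:R = e^-1 by rewrite invrK.
have e1 : e != 0 by rewrite gt_eqF.
set A0 := \sum_(1 <= t < n.+1) u t.
set A1 := \sum_(1 + h <= t < n.+1) u t; set A2 := \sum_(1 + h <= t < n.+1) v t.
have -> : \sum_(1 + h <= t < n.+1) (u t - ub) * (v t - ub) =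
    \sum_(1 + h <= t < n.+1) u t * v t - ub * (A1 + A2) + (n - h)%:R * ub ^+ 2.
  rewrite mulrDr /A1 /A2 !big_distrr /= mulr_natl.
  have -> : ub ^+ 2 *+ (n - h) = \sum_(1 + h <= t < n.+1) ub ^+ 2.
    by rewrite sumr_const_nat subSS.
  by rewrite -big_split /= -sumrB -big_split /=; apply: eq_bigr => t _; ring.
rewrite [X in _ - e * X](@big_cat_nat _ _ _ h.+1)//=.
set B := \sum_(1 <= t < h.+1) u t * v t; set S := \sum_(_ <= t < _) u t * v t.
have BE : `|B| <= \sum_(1 <= t < h.+1) (u t ^+ 2 + v t ^+ 2).
  apply: le_trans (ler_norm_sum _ _ _) _; apply: ler_sum => t _.
  rewrite normrM -(real_normK (num_real (u t))) -(real_normK (num_real (v t))).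
  have : 0 <= `|u t| by []. have : 0 <= `|v t| by [].
  have := sqr_ge0 (`|u t| - `|v t|).
  move: `|u t| `|v t| => p q; have := sqr_ge0 p; have := sqr_ge0 q; nra.
rewrite nE rE /ub nE -/A0.
have -> : e^-1 * (e ^+ 2 * (S - e ^+ 2 * A0 * (A1 + A2) + (n - h)%:R * (e ^+ 2 * A0) ^+ 2)) -
    e * (B + S) = e * (- B + e ^+ 2 * (- (A0 * (A1 + A2)) + (n - h)%:R * e ^+ 2 * A0 ^+ 2)).
  by field.
rewrite normrM (gtr0_norm e0); apply: ler_wpM2l; first exact: ltW.
apply: (le_trans (ler_normD _ _)); rewrite normrN; apply: lerD => //.
rewrite normrM (ger0_norm (sqr_ge0 _)); apply: ler_wpM2l; first exact: sqr_ge0.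
apply: (le_trans (ler_normD _ _)); rewrite normrN.
have h1 : `|A0 * (A1 + A2)| <= A0 ^+ 2 + A1 ^+ 2 + A2 ^+ 2.
  rewrite ler_norml; have := sqr_ge0 (A0 + A1); have := sqr_ge0 (A0 + A2).
  have := sqr_ge0 (A0 - A1); have := sqr_ge0 (A0 - A2).
  have := sqr_ge0 A1; have := sqr_ge0 A2; move=> *; apply/andP; split; nra.
have h2 : `|(n - h)%:R * e ^+ 2 * A0 ^+ 2| <= A0 ^+ 2.
  rewrite (ger0_norm (mulr_ge0 (mulr_ge0 (ler0n _ _) (sqr_ge0 _)) (sqr_ge0 _))).
  apply: ler_piMl; first exact: sqr_ge0.
  by rewrite -nE ler_pdivrMr ?ltr0n// mul1r ler_nat leq_subr.
apply: (le_trans (lerD h1 h2)).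
have q (a b c : R) : a + b + c + a = 2 * a + b + c by ring.
by rewrite q.
Qed.

Lemma variance_error n u : (0 < n)%N ->
  let e := (Num.sqrt n%:R)^-1 in
  let ub := n%:R^-1 * \sum_(1 <= t < n.+1) u t in
  `|n%:R^-1 * (\sum_(1 + 0 <= t < n.+1) (u t - ub) * (u t - ub)) - 1| <=
  e * (1 + e ^+ 2 * (\sum_(1 <= t < n.+1) (u t ^+ 2 - 1)) ^+ 2 +
    e ^+ 2 * (\sum_(1 <= t < n.+1) u t) ^+ 2).
Proof.
move=> n0; cbv zeta; set e := (Num.sqrt _)^-1.
set ub := n%:R^-1 * \sum_(1 <= t < n.+1) u t.
have r0 : 0 < Num.sqrt n%:R :> R by rewrite sqrtr_gt0 ltr0n.
have e0 : 0 < e by rewrite invr_gt0.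
have nE : n%:R^-1 = e ^+ 2 by rewrite /e exprVn sqr_sqrtr.
have nE' : n%:R = (e ^+ 2)^-1 by rewrite -nE invrK.
have e1 : e != 0 by rewrite gt_eqF.
have ele1 : e <= 1 
  by rewrite invf_le1// -[leLHS]sqrtr1; apply: ler_wsqrtr; rewrite ler1n.
set A0 := \sum_(1 <= t < n.+1) u t.
set B := \sum_(1 <= t < n.+1) (u t ^+ 2 - 1).
have -> : \sum_(1 + 0 <= t < n.+1) (u t - ub) * (u t - ub) =
    B + n%:R - 2 * ub * A0 + n%:R * ub ^+ 2.
  have en : (n%:R : R) = \sum_(1 <= t < n.+1) 1.
    by rewrite sumr_const_nat subSS subn0.
  rewrite /B /A0 big_distrr /= en [_ * ub ^+ 2]mulrC big_distrr /=.
  rewrite -big_split /= -sumrB -big_split /=; apply: eq_bigr => t _; ring.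
rewrite /ub nE nE' -/A0.
rewrite (_ : _ - 1 = e ^+ 2 * B - e * (e ^+ 2 * A0 ^+ 2) * e); last by field.
apply: (le_trans (ler_normB _ _)); rewrite mulrDr; apply: lerD; last first.
  have p0 : 0 <= e * (e ^+ 2 * A0 ^+ 2).
    by apply: mulr_ge0; [exact: ltW|apply: mulr_ge0; exact: sqr_ge0].
  rewrite ger0_norm; last by apply: mulr_ge0 => //; exact: ltW.
  exact: ler_piMr.
(* [|t| <= 1 + t ^+ 2] for [t = e * B] trades a first absolute moment for a second moment. *)
have -> : e ^+ 2 * B = e * (e * B) by ring.
rewrite normrM (gtr0_norm e0) ler_pM2l// -exprMn.
have := sqr_ge0 (e * B - 1); have := sqr_ge0 (e * B + 1).
move: (e * B) => t *; rewrite ler_norml; apply/andP; split; nra.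
Qed.

End sample_autocovariance.

(** The union bound for a product of probabilities: each factor loses at most [k]. *)
Lemma prod_ge_one_sub (R : realType) (I : Type) (r : seq I) (p : I -> R) (k : R) :
  0 <= k -> (forall i, 1 - k <= p i <= 1) -> (forall i, 0 <= p i) ->
  1 - (size r)%:R * k <= \prod_(i <- r) p i.
Proof.
move=> k0 pk p0; elim: r => [|i r IH]; first by rewrite big_nil mul0r subr0.
rewrite big_cons /= -natr1 mulrDl mul1r.
have q0 : 0 <= \prod_(j <- r) p j by exact: prodr_ge0.
have q1 : \prod_(j <- r) p j <= 1.
  by apply: prodr_ile1 => j _; rewrite p0; have /andP[] := pk j.
have /andP[pi1 pi2] := pk i; move: IH q0 q1.
set q := \prod_(j <- r) p j; set N := _ * k => IH q0 q1.
have : (1 - p i) * q <= k by rewrite -[leRHS]mulr1; apply: ler_pM => //; lra.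
lra.
Qed.

Lemma integrable_rv_quartic d (T : measurableType d) (R : realType)
    (P : probability T R) (f : T -> R) (h : R -> R) (K : R) :
  measurable_fun setT f -> integrable_rv P (fun w => f w ^+ 4) ->
  measurable_fun setT h -> (forall x, `|h x| <= K * (1 + x ^+ 4)) ->
  integrable_rv P (fun w => h (f w)).
Proof.
move=> mf f4 mh hK.
apply: (@integrable_rv_le _ _ _ _ _ (fun w => K * (1 + f w ^+ 4))).
- exact: measurableT_comp.
- by apply: integrable_rvZ; apply: integrable_rvD => //; exact: integrable_rv_cst.
- by move=> w; exact: hK.
Qed.

(** These are the functions of [y_t] whose means must be finite and the same for all [t]. *)
Lemma quartic_growth (R : realType) :
  let quartic (h : R -> R) K :=
    measurable_fun setT h /\ forall x, `|h x| <= K * (1 + x ^+ 4) in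
  [/\ quartic id 1, quartic (fun x => x ^+ 2) 1,
      quartic (fun x => (1 + `|x|) ^+ 3) 10 &
      quartic (fun x => (x ^+ 2 - 1) ^+ 2) 4].
Proof.
have m2 : measurable_fun setT (fun x : R => x ^+ 2) by exact: measurable_funX.
have pow4 (x : R) :
    [/\ `|x| <= 1 + x ^+ 4, x ^+ 2 <= 1 + x ^+ 4 & `|x| ^+ 3 <= 1 + x ^+ 4].
  have -> : x ^+ 4 = `|x| ^+ 4 by rewrite -[LHS]ger0_norm ?normrX// exprn_even_ge0.
  rewrite -(real_normK (num_real x)); have : 0 <= `|x| by [].
  move: `|x| => a a0; have a2 := mulr_ge0 a0 a0.
  have := sqr_ge0 (a - 1); have := sqr_ge0 (a * (a - 1)).
  have := sqr_ge0 (a ^+ 2 - 1); have := sqr_ge0 a; have := sqr_ge0 (a ^+ 2).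
  by move=> *; split; lra.
have x40 (x : R) : 0 <= x ^+ 4 by rewrite exprn_even_ge0.
split; split.
- exact: measurable_id.
- by move=> x; rewrite mul1r; have [] := pow4 x.
- exact: m2.
- by move=> x; rewrite mul1r ger0_norm ?sqr_ge0//; have [] := pow4 x.
- by apply: measurable_funX; apply: measurable_funD => //; exact: normr_measurable.
- move=> x; rewrite ger0_norm ?exprn_ge0 ?addr_ge0//; have [] := pow4 x.
  rewrite -(real_normK (num_real x)); have := x40 x.
  by move: `|x| (x ^+ 4) => b c *; lra.
- by apply: measurable_funX; apply: measurable_funB.
- move=> x; rewrite ger0_norm ?sqr_ge0//; have := sqr_ge0 x; have := x40 x.
  by move=> *; lra.
Qed.

(** * Limit law for the autocorrelations of a standardized i.i.d. sequence *)

Section sample_autocorrelation.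
Context d (T : measurableType d) (R : realType) (P : probability T R).
Variables (y : int -> T -> R) (m : nat) (M V : R).
Hypothesis my : forall t, measurable_fun setT (y t).
Hypothesis indep_y : forall k : int, independent_seq P (fun s => y (s%:Z + k)).
Hypothesis int_y4 : forall t, integrable_rv P (fun w => y t w ^+ 4).
Hypothesis mean_y1 : forall t, mean P (y t) = 0.
Hypothesis mean_y2 : forall t, mean P (fun w => y t w ^+ 2) = 1.
Hypothesis mean_y3 : forall t, mean P (fun w => (1 + `|y t w|) ^+ 3) = M.
Hypothesis mean_y4 : forall t, mean P (fun w => (y t w ^+ 2 - 1) ^+ 2) = V.

(* Slutsky without quotients: when the sample variance is close to 1, the event
   on the ratios is sandwiched between events on the numerators. *)
Let slutsky_upper (c g S : 'I_m -> R) (g0 eta k W : R) :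
  0 < eta -> (forall i, (`|c i| + 1) * k <= eta) -> k <= 2^-1 -> W < k ->
  (forall i, `|g i - S i| <= W) -> `|g0 - 1| <= W ->
  (forall i, g i * g0^-1 <= c i) -> forall i, S i <= c i + eta.
Proof.
move=> eta0 ck k2 Wk gS g01 gc i.
have g0k : `|g0 - 1| < k by exact: le_lt_trans Wk.
have g0_gt0 : 0 < g0 by move: g0k; rewrite ltr_norml => /andP[? _]; lra.
have := gc i; rewrite ler_pdivrMr// => h1.
have h2 : `|c i * (g0 - 1)| <= `|c i| * k by rewrite normrM ler_wpM2l// ltW.
have := le_trans (ler_norm _) h2; have := le_lt_trans (gS i) Wk.
rewrite ltr_norml => /andP[h3 _]; have := ck i; lra.
Qed.

Let slutsky_lower (c g S : 'I_m -> R) (g0 eta k W : R) :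
  0 < eta -> (forall i, (`|c i| + 1) * k <= eta) -> k <= 2^-1 -> W < k ->
  (forall i, `|g i - S i| <= W) -> `|g0 - 1| <= W ->
  (forall i, S i <= c i - eta) -> forall i, g i * g0^-1 <= c i.
Proof.
move=> eta0 ck k2 Wk gS g01 Sc i.
have g0k : `|g0 - 1| < k by exact: le_lt_trans Wk.
have g0_gt0 : 0 < g0 by move: g0k; rewrite ltr_norml => /andP[? _]; lra.
rewrite ler_pdivrMr//.
have h2 : `|c i * (g0 - 1)| <= `|c i| * k by rewrite normrM ler_wpM2l// ltW.
have := lerNnormlW h2; have := le_lt_trans (gS i) Wk.
rewrite ltr_norml => /andP[_ h3]; have := ck i; have := Sc i; lra.
Qed.

Let int_y t : integrable_rv P (y t).
Proof.
have [[mh hK] _ _ _] := @quartic_growth R.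
exact: integrable_rv_quartic (my t) (int_y4 t) mh hK.
Qed.

Let int_y2 t : integrable_rv P (fun w => y t w ^+ 2).
Proof.
have [_ [mh hK] _ _] := @quartic_growth R.
exact: integrable_rv_quartic (my t) (int_y4 t) mh hK.
Qed.

Let int_y3 t : integrable_rv P (fun w => (1 + `|y t w|) ^+ 3).
Proof.
have [_ _ [mh hK] _] := @quartic_growth R.
exact: integrable_rv_quartic (my t) (int_y4 t) mh hK.
Qed.

Let int_y22 t : integrable_rv P (fun w => (y t w ^+ 2 - 1) ^+ 2).
Proof.
have [_ _ _ [mh hK]] := @quartic_growth R.
exact: integrable_rv_quartic (my t) (int_y4 t) mh hK.
Qed.

Let mean_sum_y2 (k : int) a b : (a <= b)%N ->
  integrable_rv P (fun w => (\sum_(a <= t < b) y (t%:Z + k) w) ^+ 2) /\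
  mean P (fun w => (\sum_(a <= t < b) y (t%:Z + k) w) ^+ 2) = (b - a)%:R.
Proof.
move=> ab; have := @mean_sum_sqr _ _ _ P (fun s => y (s%:Z + k)) (fun=> my _)
  (indep_y k) id 1 a b ab (@measurable_id _ _ setT) (fun=> int_y _)
  (fun=> int_y2 _) (fun=> mean_y1 _) (fun=> mean_y2 _).
by rewrite mulr1.
Qed.

Let mean_sum_y2_0 a b : (a <= b)%N ->
  integrable_rv P (fun w => (\sum_(a <= t < b) y t%:Z w) ^+ 2) /\
  mean P (fun w => (\sum_(a <= t < b) y t%:Z w) ^+ 2) = (b - a)%:R.
Proof.
move=> ab; have [i1 i2] := mean_sum_y2 0 ab.
have E w : (\sum_(a <= t < b) y (t%:Z + 0) w) ^+ 2 = (\sum_(a <= t < b) y t%:Z w) ^+ 2.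
  by congr (_ ^+ 2); apply: eq_bigr => t _; rewrite addr0.
by split; [exact: eq_integrable_rv E i1|rewrite -(eq_mean _ E)].
Qed.

Let mean_sum_y4 a b : (a <= b)%N ->
  integrable_rv P (fun w => (\sum_(a <= t < b) (y t%:Z w ^+ 2 - 1)) ^+ 2) /\
  mean P (fun w => (\sum_(a <= t < b) (y t%:Z w ^+ 2 - 1)) ^+ 2) = (b - a)%:R * V.
Proof.
move=> ab; have [|t|t|t|t|i1 i2] := @mean_sum_sqr _ _ _ P (fun s => y (s%:Z + 0))
  (fun=> my _) (indep_y 0) (fun x => x ^+ 2 - 1) V a b ab.
- by apply: measurable_funB => //; exact: measurable_funX.
- by apply: integrable_rvB => //; exact: integrable_rv_cst.
- exact: int_y22.
- by rewrite meanB ?mean_cst ?mean_y2 ?subrr//; exact: integrable_rv_cst.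
- exact: mean_y4.
have E w : (\sum_(a <= t < b) (y (t%:Z + 0) w ^+ 2 - 1)) ^+ 2 =
    (\sum_(a <= t < b) (y t%:Z w ^+ 2 - 1)) ^+ 2.
  by congr (_ ^+ 2); apply: eq_bigr => t _; rewrite addr0.
by split; [exact: eq_integrable_rv E i1|rewrite -(eq_mean _ E)].
Qed.

Let e n : R := (Num.sqrt n%:R)^-1.
Let gam n h w : R := sample_autocov n (y ^~ w) h.
(** [Z (k + m)] is [y] at time [k + 1]: the terms [0 <= k < n] of the lag sum are the times 1 to
    [n], preceded by [m] presample values. *)
Let Z (s : nat) := y (s%:Z + (1 - m%:Z)).

Let lag_sumE n (i : 'I_m) w : lag_sum Z (e n) n i w =
  e n * \sum_(1 <= t < n.+1) y t%:Z w * y (t%:Z - i.+1%:Z) w.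
Proof.
rewrite /lag_sum big_add1; congr (_ * _); apply: eq_bigr => t _.
have im := ltn_ord i; rewrite /lag_product /Z; congr (y _ w * y _ w); lia.
Qed.

(** In mean, each of the at most [m] boundary terms gives 2, and the squared sums give at most
    [4 * n], divided by [n]. *)
Lemma mean_lag_covariance_error n (i : 'I_m) : (m <= n)%N -> (0 < n)%N ->
  exists B : T -> R, [/\ integrable_rv P B,
    mean P B <= (2 * m%:R + 4) * e n &
    forall w, `|Num.sqrt n%:R * gam n i.+1 w - lag_sum Z (e n) n i w| <= B w].
Proof.
move=> mn n0; pose h := i.+1; have hn : (h <= n)%N by apply: leq_trans mn; exact: ltn_ord.
have e0 : 0 <= e n by rewrite invr_ge0.
have e2 : n%:R * e n ^+ 2 = 1.
  by rewrite /e exprVn sqr_sqrtr ?ler0n// divff// pnatr_eq0 -lt0n.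
pose B w := e n * (\sum_(1 <= t < h.+1) (y t%:Z w ^+ 2 + y (t%:Z - h%:Z) w ^+ 2) +
    e n ^+ 2 * (2 * (\sum_(1 <= t < n.+1) y t%:Z w) ^+ 2 +
      (\sum_(1 + h <= t < n.+1) y t%:Z w) ^+ 2 +
      (\sum_(1 + h <= t < n.+1) y (t%:Z - h%:Z) w) ^+ 2)).
have hn' : (1 + h <= n.+1)%N by rewrite add1n ltnS.
have [i0 m0] := @mean_sum_y2_0 1 n.+1 isT.
have [i1 m1] := mean_sum_y2_0 hn'; have [i2 m2] := mean_sum_y2 (- h%:Z) hn'.
have iy t : integrable_rv P (fun w => y t%:Z w ^+ 2 + y (t%:Z - h%:Z) w ^+ 2).
  exact: integrable_rvD.
have i3 := @integrable_rv_sum _ _ _ P _ (index_iota 1 h.+1) xpredT _ (fun t _ => iy t).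
have i4 := integrable_rvD (integrable_rvD (integrable_rvZ 2 i0) i1) i2.
have i5 := integrable_rvD i3 (integrable_rvZ (e n ^+ 2) i4).
exists B; split.
- exact: integrable_rvZ i5.
- rewrite /B (meanZ _ i5) (meanD i3 (integrable_rvZ _ i4)) (meanZ _ i4).
  rewrite (meanD (integrable_rvD (integrable_rvZ 2 i0) i1) i2).
  rewrite (meanD (integrable_rvZ 2 i0) i1) (meanZ _ i0) m0 m1 m2.
  rewrite (mean_sum _ (fun t _ => iy t)).
  rewrite (eq_bigr (fun=> 2)) => [|t _]; last by rewrite meanD// !mean_y2.
  rewrite sumr_const_nat mulrC; apply: ler_wpM2r => //.
  have h1 : 2 *+ (h.+1 - 1) <= 2 * m%:R :> R.
    rewrite subn1 -[leLHS]mulr_natr; apply: ler_wpM2l => //.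
    by rewrite ler_nat; exact: ltn_ord.
  apply: lerD => //.
  have h2 : (n.+1 - (1 + h))%:R <= n%:R :> R by rewrite ler_nat; lia.
  have h3 : (n.+1 - 1)%:R = n%:R :> R by rewrite subn1.
  apply: (@le_trans _ _ (e n ^+ 2 * (4 * n%:R))).
    apply: ler_wpM2l; first exact: sqr_ge0.
    rewrite h3; move: (n%:R : R) ((n.+1 - (1 + h))%:R : R) h2 => p q; lra.
  by rewrite mulrCA [e n ^+ 2 * _]mulrC e2 mulr1.
- move=> w; rewrite lag_sumE /gam /sample_autocov /sample_mean.
  exact: lag_covariance_error.
Qed.

(** Up to the factor [e n], the three terms of [variance_error] have means 1, [V] and 1. *)
Lemma mean_variance_error n : (0 < n)%N ->
  exists B : T -> R, [/\ integrable_rv P B, mean P B <= (V + 2) * e n &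
    forall w, `|gam n 0 w - 1| <= B w].
Proof.
move=> n0; have e0 : 0 <= e n by rewrite invr_ge0.
have e2 : n%:R * e n ^+ 2 = 1.
  by rewrite /e exprVn sqr_sqrtr ?ler0n// divff// pnatr_eq0 -lt0n.
pose B w := e n * (1 + e n ^+ 2 * (\sum_(1 <= t < n.+1) (y t%:Z w ^+ 2 - 1)) ^+ 2 +
    e n ^+ 2 * (\sum_(1 <= t < n.+1) y t%:Z w) ^+ 2).
have [i0 m0] := @mean_sum_y2_0 1 n.+1 isT.
have [i1 m1] := @mean_sum_y4 1 n.+1 isT.
have i2 := integrable_rvD (integrable_rv_cst P 1) (integrable_rvZ (e n ^+ 2) i1).
have i3 := integrable_rvD i2 (integrable_rvZ (e n ^+ 2) i0).
exists B; split.
- exact: integrable_rvZ i3.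
- rewrite /B (meanZ _ i3) (meanD i2 (integrable_rvZ _ i0)) (meanZ _ i0).
  rewrite (meanD (integrable_rv_cst P 1) (integrable_rvZ _ i1)) (meanZ _ i1).
  rewrite m0 m1 mean_cst subn1 /= mulrA ![e n ^+ 2 * n%:R]mulrC e2.
  by rewrite mulrC mul1r addrAC [1 + 1 + V]addrC.
- move=> w; rewrite /gam /sample_autocov /sample_mean.
  have -> : \sum_(1 + 0 <= t < n.+1)
      (y t%:Z w - n%:R^-1 * \sum_(1 <= t0 < n.+1) y t0%:Z w) *
      (y (t%:Z - 0%:Z) w - n%:R^-1 * \sum_(1 <= t0 < n.+1) y t0%:Z w) =
    \sum_(1 + 0 <= t < n.+1)
      (y t%:Z w - n%:R^-1 * \sum_(1 <= t0 < n.+1) y t0%:Z w) *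
      (y t%:Z w - n%:R^-1 * \sum_(1 <= t0 < n.+1) y t0%:Z w).
    by apply: eq_bigr => t _; rewrite subr0.
  exact: variance_error.
Qed.

Let D : R := m%:R * (2 * m%:R + 4) + (V + 2).

(** One variable dominates all errors, so that the single event [W < k] controls numerators and
    denominator together. *)
Lemma mean_autocov_error n : (m <= n)%N -> (0 < n)%N ->
  exists W : T -> R, [/\ integrable_rv P W, mean P W <= D * e n,
    (forall w, 0 <= W w) ,
    (forall (i : 'I_m) w, `|Num.sqrt n%:R * gam n i.+1 w - lag_sum Z (e n) n i w| <= W w) &
    forall w, `|gam n 0 w - 1| <= W w].
Proof.
move=> mn n0.
have /choice[B BP] := fun i : 'I_m => mean_lag_covariance_error i mn n0.
have [B0 [iB0 mB0 B0P]] := mean_variance_error n0.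
have iB i : integrable_rv P (B i) by have [] := BP i.
have B_ge0 i w : 0 <= B i w by have [_ _ h] := BP i; exact: le_trans (h w).
have B0_ge0 w : 0 <= B0 w by exact: le_trans (B0P w).
have iS := @integrable_rv_sum _ _ _ P _ (index_enum 'I_m) xpredT _ (fun i _ => iB i).
exists (fun w => \sum_(i < m) B i w + B0 w); split.
- exact: integrable_rvD.
- rewrite meanD// (mean_sum _ (fun i _ => iB i)) /D mulrDl; apply: lerD => //.
  apply: (@le_trans _ _ (\sum_(i < m) (2 * m%:R + 4) * e n)).
    by apply: ler_sum => i _; have [] := BP i.
  by rewrite sumr_const card_ord -[leLHS]mulr_natl mulrA.
- by move=> w; rewrite addr_ge0// sumr_ge0.
- move=> i w; have [_ _ h] := BP i; apply: (le_trans (h w)).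
  by rewrite (bigD1 i)//= -addrA lerDl addr_ge0// sumr_ge0.
- by move=> w; apply: (le_trans (B0P w)); rewrite lerDr sumr_ge0.
Qed.

Lemma measurable_gam n h : measurable_fun setT (gam n h).
Proof.
have mm : measurable_fun setT (fun w => sample_mean n (y ^~ w)).
  apply: measurable_funM; first exact: measurable_cst.
  by apply: measurable_sum_nat => t _.
apply: measurable_funM; first exact: measurable_cst.
by apply: measurable_sum_nat => t _; apply: measurable_funM; exact: measurable_funB.
Qed.

Lemma measurable_autocorr n h :
  measurable_fun setT (fun w => sample_autocorr n (y ^~ w) h).
Proof.
apply: measurable_funM; first exact: measurable_gam.
have gam0 w : 0 <= gam n 0 w.
  apply: mulr_ge0; first by rewrite invr_ge0.
  by apply: sumr_ge0 => t _; rewrite subr0 -expr2 sqr_ge0.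
(* The inverse is the power of exponent -1 because the sample variance is nonnegative; both are 0 at
   0. *)
rewrite (_ : (fun w => _) = fun w => gam n 0 w `^ (-1)).
  apply: (measurableT_comp (f := @powR R ^~ (-1))); first exact: measurable_powR.
  exact: measurable_gam.
by apply/funext => w; rewrite powR_inv1.
Qed.

Definition autocorr_event n (c : 'I_m -> R) : set T :=
  [set w | forall i : 'I_m, Num.sqrt n%:R * sample_autocorr n (y ^~ w) i.+1 <= c i].

Lemma measurable_autocorr_event n c : measurable (autocorr_event n c).
Proof.
rewrite (_ : autocorr_event n c = \bigcap_(i in [set: 'I_m])
    ((fun w => Num.sqrt n%:R * sample_autocorr n (y ^~ w) i.+1) @^-1` `]-oo, c i])).
  apply: fin_bigcap_measurable => [|i _]; first exact: finite_finset.
  rewrite -[X in measurable X]setTI.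
  have mf : measurable_fun setT (fun w => Num.sqrt n%:R * sample_autocorr n (y ^~ w) i.+1).
    by apply: measurable_funM; [exact: measurable_cst|exact: measurable_autocorr].
  by apply: mf => //; exact: measurable_itv.
apply/seteqP; split=> w h i; first by move=> _; rewrite /= in_itv /= h.
by have := h i I; rewrite /= in_itv.
Qed.

(** Each factor is a Gaussian distribution function of standard deviation [eta ^+ 2]. At distance
    [eta] from the threshold the argument is [1 / eta] deviations, where the factor is close to 0 or
    1. *)
Let smooth (eta : R) n (c : 'I_m -> R) w : R :=
  \prod_(i < m) heat 0 (eta ^+ 4) (c i - lag_sum Z (e n) n i w).

Let mS n (i : 'I_m) : measurable_fun setT (lag_sum Z (e n) n i).
Proof.
apply: measurable_funM; first exact: measurable_cst.
by apply: measurable_sum_nat => t _; apply: measurable_funM; exact: my.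
Qed.

Let int_smooth eta n c : integrable_rv P (smooth eta n c).
Proof.
apply: (integrable_rv_le _ (integrable_rv_cst P 1)) => [|w].
  apply: measurable_prod => l _; apply: measurableT_comp; first exact: measurable_heat.
  exact: measurable_funB.
rewrite ger0_norm; last by apply: prodr_ge0 => i _; exact: heat0_ge0.
by apply: prodr_ile1 => i _; rewrite heat0_ge0 heat0_le1.
Qed.

Let heat_eta4 (eta u : R) : heat 0 (eta ^+ 4) u = gauss_cdf (u / eta ^+ 2).
Proof.
rewrite /heat (_ : eta ^+ 4 = (eta ^+ 2) ^+ 2); last by rewrite -exprM.
by rewrite sqrtr_sqr ger0_norm ?sqr_ge0.
Qed.

Let heat_eta_ge (eta u : R) : 0 < eta -> eta <= u ->
  gauss_cdf eta^-1 <= heat 0 (eta ^+ 4) u.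
Proof.
move=> eta0 etau; rewrite heat_eta4; apply: gauss_cdf_nondecreasing.
rewrite ler_pdivlMr ?exprn_gt0// expr2 mulrA mulVf ?mul1r//.
by rewrite gt_eqF.
Qed.

Let heat_eta_le (eta u : R) : 0 < eta -> u <= - eta ->
  heat 0 (eta ^+ 4) u <= gauss_cdf (- eta^-1).
Proof.
move=> eta0 etau; rewrite heat_eta4; apply: gauss_cdf_nondecreasing.
rewrite ler_pdivrMr ?exprn_gt0// expr2 mulrA mulNr mulVf ?mulN1r//.
by rewrite gt_eqF.
Qed.

Let autocorrE n (i : 'I_m) w : Num.sqrt n%:R * sample_autocorr n (y ^~ w) i.+1 =
  Num.sqrt n%:R * gam n i.+1 w * (gam n 0 w)^-1.
Proof. by rewrite mulrA. Qed.

(** If [k <= W w], the last term is at least 1: a pointwise Markov bound. Otherwise the event forces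
    [S_i <= c_i + eta], every factor is at least [gauss_cdf eta^-1], and the union bound applies. *)
Let indic_upper (eta k : R) n (c : 'I_m -> R) (W : T -> R) w :
  0 < eta -> 0 < k -> (forall i, (`|c i| + 1) * k <= eta) -> k <= 2^-1 ->
  0 <= W w ->
  (forall i : 'I_m, `|Num.sqrt n%:R * gam n i.+1 w - lag_sum Z (e n) n i w| <= W w) ->
  `|gam n 0 w - 1| <= W w ->
  \1_(autocorr_event n c) w <= smooth eta n (fun i => c i + 2 * eta) w +
    m%:R * (1 - gauss_cdf eta^-1) + k^-1 * W w.
Proof.
move=> eta0 k0 ck k2 W0 h1 h2.
have s0 : 0 <= smooth eta n (fun i => c i + 2 * eta) w.
  by apply: prodr_ge0 => i _; exact: heat0_ge0.
have p0 : 0 <= 1 - gauss_cdf eta^-1 by rewrite subr_ge0 gauss_cdf_le1.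
have pm : 0 <= m%:R * (1 - gauss_cdf eta^-1) by exact: mulr_ge0.
have W1 : 0 <= k^-1 * W w by rewrite mulr_ge0// invr_ge0 ltW.
have sum0 := addr_ge0 (addr_ge0 s0 pm) W1.
rewrite indicE; have [wA|_] := boolP (w \in autocorr_event n c); last exact: sum0.
have [Wk|kW] := ltP (W w) k; last first.
  have : 1 <= k^-1 * W w by rewrite mulrC ler_pdivlMr// mul1r.
  by rewrite /=; lra.
move: wA; rewrite inE => wA.
have gc (i : 'I_m) : Num.sqrt n%:R * gam n i.+1 w * (gam n 0 w)^-1 <= c i.
  by rewrite -autocorrE; exact: wA.
have := slutsky_upper eta0 ck k2 Wk h1 h2 gc => Sc.
have := @prod_ge_one_sub R _ (index_enum 'I_m)
  (fun i => heat 0 (eta ^+ 4) (c i + 2 * eta - lag_sum Z (e n) n i w)) _ p0.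
have -> : size (index_enum 'I_m) = m by rewrite -[RHS]card_ord cardE enumT.
move=> h; have {}h := h _ _.
suff : 1 - m%:R * (1 - gauss_cdf eta^-1) <= smooth eta n (fun i => c i + 2 * eta) w.
  by rewrite /=; lra.
apply: h => i; last exact: heat0_ge0.
rewrite heat0_le1 andbT opprB addrCA subrr addr0; apply: heat_eta_ge => //.
have := Sc i; lra.
Qed.

(** If [W w < k], either some [S_i > c_i - eta], and that single factor is at most
    [gauss_cdf (- eta^-1)], or the event occurs. *)
Let indic_lower (eta k : R) n (c : 'I_m -> R) (W : T -> R) w :
  0 < eta -> 0 < k -> (forall i, (`|c i| + 1) * k <= eta) -> k <= 2^-1 ->
  0 <= W w ->
  (forall i : 'I_m, `|Num.sqrt n%:R * gam n i.+1 w - lag_sum Z (e n) n i w| <= W w) ->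
  `|gam n 0 w - 1| <= W w ->
  smooth eta n (fun i => c i - 2 * eta) w <= \1_(autocorr_event n c) w +
    gauss_cdf (- eta^-1) + k^-1 * W w.
Proof.
move=> eta0 k0 ck k2 W0 h1 h2.
have s1 : smooth eta n (fun i => c i - 2 * eta) w <= 1.
  by apply: prodr_ile1 => i _; rewrite heat0_ge0 heat0_le1.
have p0 := gauss_cdf_ge0 (- eta^-1).
have W1 : 0 <= k^-1 * W w by rewrite mulr_ge0// invr_ge0 ltW.
have i0 : 0 <= \1_(autocorr_event n c) w :> R by rewrite indicE.
have [Wk|kW] := ltP (W w) k; last first.
  have : 1 <= k^-1 * W w by rewrite mulrC ler_pdivlMr// mul1r.
  by move=> ?; lra.
have [/existsP[i ci]|] := boolP [exists i : 'I_m, c i - eta < lag_sum Z (e n) n i w].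
  suff : smooth eta n (fun i => c i - 2 * eta) w <= gauss_cdf (- eta^-1).
    by move=> ?; lra.
  rewrite /smooth (bigD1 i)//=.
  apply: (@le_trans _ _ (heat 0 (eta ^+ 4) (c i - 2 * eta - lag_sum Z (e n) n i w))).
    apply: ler_piMr; first exact: heat0_ge0.
    by apply: prodr_ile1 => j _; rewrite heat0_ge0 heat0_le1.
  apply: heat_eta_le => //; lra.
rewrite negb_exists => /forallP Sc.
have wA : autocorr_event n c w.
  move=> i; rewrite autocorrE; apply: (slutsky_lower eta0 ck k2 Wk h1 h2) => j.
  by have := Sc j; rewrite -leNgt.
rewrite indicE mem_set//=; lra.
Qed.

Let limit_cdf (eta : R) (c : 'I_m -> R) : R := \prod_(i < m) heat 0 (1 + eta ^+ 4) (c i).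

(** Means of the two pointwise bounds, with [lindeberg] for the smooth parts. The constant depends
    on [eta] and [c] but not on [n]. *)
Lemma autocorr_sandwich (c : 'I_m -> R) (eta : R) : 0 < eta -> eta < 1 ->
  exists2 K : R, 0 <= K & forall n, (m <= n)%N -> (0 < n)%N ->
    limit_cdf eta (fun i => c i - 2 * eta) - gauss_cdf (- eta^-1) - K * e n <=
      mean P \1_(autocorr_event n c) <=
    limit_cdf eta (fun i => c i + 2 * eta) + m%:R * (1 - gauss_cdf eta^-1) + K * e n.
Proof.
move=> eta0 eta1; have eta4 : 0 < eta ^+ 4 by exact: exprn_gt0.
have lind := @lindeberg _ _ _ _ Z m M (fun=> my _) (indep_y _)
  (fun=> int_y3 _) (fun=> mean_y3 _) (fun=> mean_y1 _) (fun=> mean_y2 _).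
have [C1 C10 hC1] := lind _ (fun i => c i + 2 * eta) eta4.
have [C2 C20 hC2] := lind _ (fun i => c i - 2 * eta) eta4.
pose s := 1 + \sum_(i < m) `|c i|.
have s1 : 1 <= s by rewrite lerDl sumr_ge0.
have s0 : 0 < s by exact: lt_le_trans s1.
have s00 : s != 0 by rewrite gt_eqF.
(* This choice gives [(|c i| + 1) * k <= eta / 2] for every [i], and [k <= 1/2] because
   [eta < 1 <= s]. *)
pose k := eta / (2 * s); have k0 : 0 < k by rewrite divr_gt0// mulr_gt0.
have ck i : (`|c i| + 1) * k <= eta.
  apply: (@le_trans _ _ (s * k)).
    apply: ler_wpM2r; first exact: ltW.
    by rewrite addrC lerD2l (bigD1 i)//= lerDl sumr_ge0.
  have -> : s * k = eta / 2 by rewrite /k; field.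
  lra.
have k2 : k <= 2^-1.
  rewrite /k invfM mulrA; apply: (@le_trans _ _ (eta / 2)); last by lra.
  by apply: ler_piMr; [apply: divr_ge0 => //; exact: ltW|rewrite invf_le1].
have D0 : 0 <= D.
  have V0 : 0 <= V by rewrite -(mean_y4 0); apply: mean_ge0 => w; exact: sqr_ge0.
  by rewrite /D addr_ge0 ?mulr_ge0 ?addr_ge0 ?mulr_ge0.
have k1 : 0 <= k^-1 by rewrite invr_ge0 ltW.
exists (C1 + C2 + k^-1 * D); first by rewrite !addr_ge0// mulr_ge0.
move=> n mn n0; have e0 : 0 <= e n by rewrite invr_ge0.
have [W [iW mW W0 hS hg]] := mean_autocov_error mn n0.
have iA := integrable_rv_indic P (measurable_autocorr_event n c).
have kW : k^-1 * mean P W <= k^-1 * D * e n by rewrite -mulrA; exact: ler_wpM2l.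
have {}hC1 : `|mean P (smooth eta n (fun i => c i + 2 * eta)) -
  limit_cdf eta (fun i => c i + 2 * eta)| <= C1 * e n := hC1 n n0.
have {}hC2 : `|mean P (smooth eta n (fun i => c i - 2 * eta)) -
  limit_cdf eta (fun i => c i - 2 * eta)| <= C2 * e n := hC2 n n0.
have C1e := mulr_ge0 C10 e0; have C2e := mulr_ge0 C20 e0.
have iWk := integrable_rvZ k^-1 iW.
rewrite (mulrDl (C1 + C2)) (mulrDl C1); apply/andP; split.
  have h : mean P (smooth eta n (fun i => c i - 2 * eta)) <=
      mean P \1_(autocorr_event n c) + gauss_cdf (- eta^-1) + k^-1 * mean P W.
    have icst := integrable_rv_cst P (gauss_cdf (- eta^-1)).
    rewrite -(meanZ _ iW) -[gauss_cdf _](mean_cst P) -(meanD iA icst).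
    rewrite -(meanD (integrable_rvD iA icst) iWk).
    apply: le_mean; first exact: int_smooth.
      exact: (integrable_rvD (integrable_rvD iA icst) iWk).
    by move=> w; apply: indic_lower (hg w).
  move: hC2; rewrite ler_norml => /andP[h1 h2]; lra.
have h : mean P \1_(autocorr_event n c) <=
    mean P (smooth eta n (fun i => c i + 2 * eta)) +
    m%:R * (1 - gauss_cdf eta^-1) + k^-1 * mean P W.
  have icst := integrable_rv_cst P (m%:R * (1 - gauss_cdf eta^-1)).
  have iG := int_smooth eta n (fun i => c i + 2 * eta).
  rewrite -(meanZ _ iW) -[m%:R * _](mean_cst P) -(meanD iG icst).
  rewrite -(meanD (integrable_rvD iG icst) iWk).
  apply: le_mean; first exact: iA.
    exact: (integrable_rvD (integrable_rvD iG icst) iWk).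
  by move=> w; apply: indic_upper (hg w).
move: hC1; rewrite ler_norml => /andP[h1 h2]; lra.
Qed.

Let cvg_limit_cdf (s : R) (c : 'I_m -> R) :
  limit_cdf eta (fun i => c i + s * eta) @[eta --> 0^'+] -->
  \prod_(i < m) gauss_cdf (c i).
Proof.
suff H i : gauss_cdf ((c i + s * eta) / Num.sqrt (1 + eta ^+ 4))
    @[eta --> (0 : R)^'+] --> gauss_cdf (c i).
  by apply: cvg_big => [|i _]; [exact: mul_continuous|exact: H].
apply: cvg_within_filter.
have h1 : (1 + eta ^+ 4) @[eta --> (0 : R)] --> (1 : R).
  rewrite -[X in _ --> X]addr0 -[X in _ --> _ + X](expr0n R 4).
  by apply: cvgD; [exact: cvg_cst|exact: exprn_continuous].
have h2 : Num.sqrt (1 + eta ^+ 4) @[eta --> (0 : R)] --> (1 : R).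
  by rewrite -[X in _ --> X]sqrtr1; apply: continuous_cvg => //; exact: sqrt_continuous.
have h3 : (c i + s * eta) @[eta --> (0 : R)] --> c i.
  rewrite -[X in _ --> X]addr0 -[X in _ --> _ + X](mulr0 s).
  by apply: cvgD; [exact: cvg_cst|apply: cvgM; [exact: cvg_cst|exact: cvg_id]].
apply: continuous_cvg; first exact: continuous_gauss_cdf.
rewrite -[X in _ --> X]divr1; apply: cvgM => //.
by apply: cvgV => //; exact: oner_neq0.
Qed.

Let cvg_inv_right : (eta : R)^-1 @[eta --> 0^'+] --> +oo.
Proof.
have pos : \forall eta \near (0 : R)^'+, 0 < eta by exact: nbhs_right_gt.
by apply/(cvgrVy (f := id) pos); exact: cvg_within_filter cvg_id.
Qed.

Theorem cvg_autocorr (c : 'I_m -> R) :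
  mean P \1_(autocorr_event n c) @[n --> \oo] --> \prod_(i < m) gauss_cdf (c i).
Proof.
set l := \prod_(i < m) _.
have up : limit_cdf eta (fun i => c i + 2 * eta) + m%:R * (1 - gauss_cdf eta^-1)
    @[eta --> 0^'+] --> l.
  rewrite -[X in _ --> X]addr0; apply: cvgD; first exact: cvg_limit_cdf.
  rewrite -[X in _ --> X](mulr0 m%:R); apply: cvgM; first exact: cvg_cst.
  rewrite -[X in _ --> X](subrr (1 : R)); apply: cvgB; first exact: cvg_cst.
  exact: (cvg_comp _ _ cvg_inv_right (@cvg_gauss_cdfy R)).
have lo : limit_cdf eta (fun i => c i - 2 * eta) - gauss_cdf (- eta^-1)
    @[eta --> 0^'+] --> l.
  rewrite -[X in _ --> X]subr0; apply: cvgB.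
    have cE : (fun eta => limit_cdf eta (fun i => c i + - 2 * eta)) =
        (fun eta => limit_cdf eta (fun i => c i - 2 * eta)).
      by apply/funext => eta; congr limit_cdf; apply/funext => i; rewrite mulNr.
    by rewrite -cE; exact: (@cvg_limit_cdf (- 2) c).
  apply: (cvg_comp _ _ _ (@cvg_gauss_cdfNy R)).
  by apply/cvgNrNy; exact: cvg_inv_right.
apply/cvgrPdist_le => eps eps0.
have eps2 : 0 < eps / 2 by rewrite divr_gt0.
move/cvgrPdist_le : up => /(_ _ eps2) up; move/cvgrPdist_le : lo => /(_ _ eps2) lo.
(* [eta] is fixed before [n], because the constant [K] obtained next depends on it. *)
have [eta [eta0 eta1 hup hlo]] : exists eta : R, [/\ 0 < eta, eta < 1,
    `|l - (limit_cdf eta (fun i => c i + 2 * eta) + m%:R * (1 - gauss_cdf eta^-1))| <= eps / 2 &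
    `|l - (limit_cdf eta (fun i => c i - 2 * eta) - gauss_cdf (- eta^-1))| <= eps / 2].
  apply: (@filter_ex _ (0 : R)^'+); near=> eta; split.
  - by near: eta; exact: nbhs_right_gt.
  - by near: eta; exact: nbhs_right_lt.
  - by near: eta; exact: up.
  - by near: eta; exact: lo.
have [K K0 sandwich] := autocorr_sandwich c eta0 eta1.
near=> n.
have n0 : (0 < n)%N by near: n; exists 1%N.
have mn : (m <= n)%N by near: n; exists m.
have Ke : K * e n <= eps / 2.
  have Kn : (2 * K / eps) ^+ 2 <= n%:R by near: n; exact: nbhs_infty_ger.
  have r0 : 0 < Num.sqrt n%:R :> R by rewrite sqrtr_gt0 ltr0n.
  rewrite /e ler_pdivrMr// mulrAC ler_pdivlMr// mulrC -ler_pdivrMl//.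
  have := ler_wsqrtr Kn; rewrite sqrtr_sqr ger0_norm; last first.
    by rewrite divr_ge0// ?mulr_ge0// ltW.
  by rewrite [eps^-1 * _]mulrC.
have /andP[s1 s2] := sandwich n mn n0.
move: hup hlo; rewrite !ler_norml => /andP[u1 u2] /andP[l1 l2].
by apply/andP; split; lra.
Unshelve. all: by end_near. Qed.

End sample_autocorrelation.

(** * Power returns *)

(** An interval of indices becomes a finite set of shifted integers, whose enumeration need not be
    increasing; hence the passage through a permutation. *)
Lemma independent_seq_comp d d' (T : measurableType d) (E : measurableType d')
    (R : realType) (P : probability T R) (Y : int -> T -> E) (f : E -> R) (k : int) :
  measurable_fun setT f -> independent_family P Y ->
  independent_seq P (fun s w => f (Y (s%:Z + k) w)).
Proof.
move=> mf indepY a b B mB.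
pose r := [seq s%:Z + k | s <- index_iota a b].
have ur : uniq r.
  by rewrite map_inj_uniq ?iota_uniq// => s s' /addIr [].
pose J := [fset t in r]%fset.
have JP : perm_eq J r.
  by apply: uniq_perm; rewrite ?fset_uniq// => t; rewrite inE.
(* [absz] recovers the index from the time; only times [s + k] with [s] natural occur. *)
pose C (t : int) := f @^-1` B (absz (t - k)%R).
have sK (s : nat) : absz (s%:Z + k - k)%R = s by rewrite addrK.
have mC t : t \in J -> measurable (C t).
  by move=> _; rewrite -[C t]setTI; apply: mf.
have JE : \bigcap_(t in [set` J]) Y t @^-1` C t =
    \big[setI/setT]_(a <= s < b) (fun w => f (Y (s%:Z + k) w)) @^-1` B s.
  transitivity (\big[setI/setT]_(t <- r) (Y t @^-1` C t)).
    rewrite -bigcap_seq; congr bigcap.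
    by apply/funext => t /=; rewrite (perm_mem JP).
  by rewrite big_map; apply: eq_bigr => s _; rewrite /C sK.
rewrite -JE indepY// (perm_big r)//= big_map.
by apply: eq_bigr => s _; rewrite /C sK.
Qed.

Section identically_distributed.
Context d d' (T : measurableType d) (E : measurableType d') (R : realType).
Variables (P : probability T R) (Y : int -> T -> E).
Hypothesis mY : forall t, measurable_fun setT (Y t).
Hypothesis identY : identically_distributed P Y.

Lemma mean_identically_distributed (g : E -> R) : measurable_fun setT g ->
  (forall t, integrable_rv P (fun w => g (Y t w))) ->
  forall t s, mean P (fun w => g (Y t w)) = mean P (fun w => g (Y s w)).
Proof.
move=> mg ig t s; congr fine.
pose RV u : {RV P >-> E} := HB.pack (Y u) (isMeasurableFun.Build _ _ _ _ _ (mY u)).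
have H u : (\int[P]_w (g (Y u w))%:E = \int[distribution P (RV u)]_x (g x)%:E)%E.
  by rewrite integral_distribution//; [exact/measurable_EFinP|exact: ig].
rewrite !H; apply: eq_measure_integral => B mB _; exact: identY.
Qed.

End identically_distributed.

Section power_returns.
Context d (T : measurableType d) (R : realType) (P : probability T R).
Variables (delta sigma : R) (vol : int -> T -> R).
Variables (eta : int -> {RV P >-> R}) (a : int -> {RV P >-> bool}).
Hypotheses (delta0 : 0 < delta) (sigma0 : 0 < sigma).
Hypothesis vol_sigma : forall t w, vol t w = sigma.
Hypothesis hvar : forall t : int,
  cond_expectation P (fun w => eta t w ^+ 2) [set w | a t w] = 1%E.
Hypothesis hident : identically_distributed P (innovation_pair eta a).
Hypothesis hmoment : forall t : int,
  ('E_P[(fun w => `|eta t w| `^ (4 * delta))%R] < +oo)%E.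
Hypothesis ha : forall t : int, (0 < P [set w | a t w] < 1)%E.

(** The power return is a single function of the pair [(eta_t, a_t)]: independence and equality in
    law are assumed between pairs, while the two components may be dependent. *)
Let pair_power (p : R * bool) : R := `|p.2%:R * (sigma * p.1)| `^ delta.

Let xr t w : R := `|observed_return vol eta a t w| `^ delta.

Let xrE t w : xr t w = pair_power (innovation_pair eta a t w).
Proof. by rewrite /xr /observed_return /latent_return vol_sigma. Qed.

Let measurable_pair_power : measurable_fun setT pair_power.
Proof.
apply: (measurableT_comp (f := @powR R ^~ delta)); first exact: measurable_powR.
apply: measurableT_comp; first exact: normr_measurable.
apply: measurable_funM; last first.
  by apply: measurable_funM; [exact: measurable_cst|exact: measurable_fst].
apply: (measurableT_comp (f := fun b : bool => b%:R : R)); last exact: measurable_snd.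
by [].
Qed.

Let measurable_innovation t : measurable_fun setT (innovation_pair eta a t).
Proof. by apply/measurable_fun_pair; exact: measurable_funPT. Qed.

Let measurable_xr t : measurable_fun setT (xr t).
Proof.
rewrite (_ : xr t = pair_power \o innovation_pair eta a t).
  exact: measurableT_comp measurable_pair_power (measurable_innovation t).
by apply/funext => w; exact: xrE.
Qed.

Let xr_ge0 t w : 0 <= xr t w. Proof. exact: powR_ge0. Qed.

Let measurable_event t : measurable [set w | a t w].
Proof.
have -> : [set w | a t w] = a t @^-1` [set true].
  by apply/seteqP; split=> w /=; case: (a t w).
exact: measurable_funPTI.
Qed.

Let xr_eq0 t w : ~~ a t w -> xr t w = 0.
Proof.
move=> /negPf aw; rewrite xrE /pair_power /= aw mul0r normr0 powR0//.
by rewrite gt_eqF.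
Qed.

(** The fourth power is [sigma^(4 delta) |eta_t|^(4 delta)] where [a_t = 1], and 0 elsewhere because
    [delta > 0]. *)
Let int_xr4 t : integrable_rv P (fun w => xr t w ^+ 4).
Proof.
have int_eta : integrable_rv P (fun w => `|eta t w| `^ (4 * delta)).
  have m1 : measurable_fun setT (fun w => `|eta t w| `^ (4 * delta)).
    apply: (measurableT_comp (f := @powR R ^~ _)); first exact: measurable_powR.
    by apply: measurableT_comp => //; exact: normr_measurable.
  apply/integrableP; split; first exact/measurable_EFinP.
  under eq_integral do rewrite /= ger0_norm ?powR_ge0//.
  by have := hmoment t; rewrite unlock.
apply: (integrable_rv_le _ (integrable_rvZ (sigma `^ (4 * delta)) int_eta)) => [|w].
  exact: measurable_funX.
rewrite ger0_norm ?exprn_ge0//; have [aw|/xr_eq0 ->] := boolP (a t w); last first.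
  by rewrite expr0n mulr_ge0 ?powR_ge0.
rewrite xrE /pair_power /= aw mul1r normrM (gtr0_norm sigma0).
rewrite -powR_mulrn ?powR_ge0// -powRrM [delta * _]mulrC powRM// ?ltW//.
Qed.

Let int_xr t : integrable_rv P (xr t).
Proof.
have [[mh hK] _ _ _] := @quartic_growth R.
exact: integrable_rv_quartic (measurable_xr t) (int_xr4 t) mh hK.
Qed.

Let mu : R := mean P (xr 0).

(** By convexity, [(x - u) ^+ 4 <= 8 * (x ^+ 4 + u ^+ 4)]. *)
Let int_centered4 t : integrable_rv P (fun w => (xr t w - mu) ^+ 4).
Proof.
apply: (integrable_rv_le _ (integrable_rvZ 8
    (integrable_rvD (int_xr4 t) (integrable_rv_cst P (mu ^+ 4))))) => [|w].
  by apply: measurable_funX; exact: measurable_funB.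
rewrite ger0_norm ?exprn_even_ge0//; move: (xr t w) mu => x u.
have := sqr_ge0 (x ^+ 2 - u ^+ 2); have := sqr_ge0 (x + u).
have := sqr_ge0 ((x + u) * (x - u)); have := sqr_ge0 ((x + u) ^+ 2); move=> *; nra.
Qed.

Let int_centered2 t : integrable_rv P (fun w => (xr t w - mu) ^+ 2).
Proof.
have [_ [mh hK] _ _] := @quartic_growth R.
have mc : measurable_fun setT (fun w => xr t w - mu) by exact: measurable_funB.
exact: integrable_rv_quartic mc (int_centered4 t) mh hK.
Qed.

(* On [a_t = 0] the power return is 0, which forces [mu = 0] if the variance
   vanishes; the return would then vanish, against the second moment of [eta_t]. *)
Let variance_gt0 : 0 < mean P (fun w => (xr 0 w - mu) ^+ 2).
Proof.
rewrite lt_neqAle mean_ge0 ?andbT; last by move=> w; exact: sqr_ge0.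
apply/eqP => var0.
have mA := measurable_event 0; pose A := [set w | a 0 w].
have mu0 : mu = 0.
  have PA : 0 < fine (P (~` A)).
    have /andP[_ p1] := ha 0; apply: fine_gt0; apply/andP; split.
      by rewrite probability_setC// sube_gt0.
    rewrite ltey_eq fin_num_measure//; exact: measurableC.
  have : mean P (fun w => mu ^+ 2 * \1_(~` A) w) <= 0.
    rewrite var0; apply: le_mean => // [|w].
      by apply: integrable_rvZ; exact: integrable_rv_indic (measurableC mA).
    rewrite indicE; have [/set_mem aw|_] := boolP (w \in ~` A).
      by rewrite mulr1 xr_eq0 ?sub0r ?sqrrN//; apply/negP.
    by rewrite mulr0 sqr_ge0.
  rewrite meanZ; last exact: integrable_rv_indic (measurableC mA).
  rewrite (mean_indic _ (measurableC mA)) pmulr_lle0// => mu2.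
  by apply/eqP; rewrite -sqrf_eq0 eq_le mu2 sqr_ge0.
(* A nonnegative variable of mean 0 vanishes almost everywhere. On [A] the return is
   [sigma * eta 0], so [eta 0] vanishes there too. *)
have xr0 : ae_eq P setT (EFin \o xr 0) (cst 0%E).
  apply/ae_eq_integral_abs => //; first exact/measurable_EFinP.
  under eq_integral do rewrite /= ger0_norm//.
  rewrite -[LHS]fineK ?integrable_fin_num//; last exact: int_xr.
  by congr EFin; exact: mu0.
have : (\int[P]_(w in A) (eta 0 w ^+ 2)%:E = 0)%E.
  rewrite (ae_eq_integral (cst 0%E))//.
  - by rewrite integral0.
  - exact/measurable_EFinP/measurable_funTS/measurable_funX.
  - case: xr0 => N [mN PN sN]; exists N; split=> // w /= h; apply: sN => /= h'.
    apply: h => aw; have := h' I; rewrite xrE /pair_power /= aw mul1r => -[].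
    move=> /powR_eq0_eq0 /normr0_eq0 /eqP; rewrite mulf_eq0 gt_eqF//= => /eqP ->.
    by rewrite expr0n.
have := hvar 0; rewrite /cond_expectation => + I0; rewrite I0 mule0.
by move/eqP; rewrite eq_sym onee_eq0.
Qed.

Let tau : R := Num.sqrt (mean P (fun w => (xr 0 w - mu) ^+ 2)).

Let tau_gt0 : 0 < tau. Proof. by rewrite sqrtr_gt0. Qed.

Let g (p : R * bool) : R := tau^-1 * (pair_power p - mu).

Let measurable_g : measurable_fun setT g.
Proof.
by apply: measurable_funM; [exact: measurable_cst|exact: measurable_funB].
Qed.

Definition standardized_power t w : R := g (innovation_pair eta a t w).

Let yE t w : standardized_power t w = tau^-1 * (xr t w - mu).
Proof. by rewrite /standardized_power /g xrE. Qed.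

Lemma measurable_standardized_power t : measurable_fun setT (standardized_power t).
Proof. exact: measurableT_comp measurable_g (measurable_innovation t). Qed.

Let int_y4 t : integrable_rv P (fun w => standardized_power t w ^+ 4).
Proof.
apply: eq_integrable_rv (integrable_rvZ (tau^-1 ^+ 4) (int_centered4 t)) => w.
by rewrite yE exprMn.
Qed.

(** Transfers each mean to time 0, where [mu] and [tau] are defined. *)
Let mean_quartic (h : R -> R) (K : R) :
  measurable_fun setT h /\ (forall x, `|h x| <= K * (1 + x ^+ 4)) ->
  forall t, mean P (fun w => h (standardized_power t w)) =
    mean P (fun w => h (standardized_power 0 w)).
Proof.
move=> [mh hK] t; apply: (mean_identically_distributed measurable_innovation hident
  (g := h \o g)); first exact: measurableT_comp.
move=> u.
exact: integrable_rv_quartic (measurable_standardized_power u) (int_y4 u) mh hK.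
Qed.

Let mean_y1 t : mean P (standardized_power t) = 0.
Proof.
have [h _ _ _] := @quartic_growth R; rewrite (mean_quartic h).
have icst := integrable_rv_cst P mu.
rewrite (eq_mean _ (yE 0)) meanZ; last exact: integrable_rvB (int_xr 0) icst.
by rewrite meanB// mean_cst subrr mulr0.
Qed.

Let mean_y2 t : mean P (fun w => standardized_power t w ^+ 2) = 1.
Proof.
have [_ h _ _] := @quartic_growth R; rewrite (mean_quartic h).
have E w : standardized_power 0 w ^+ 2 = tau^-1 ^+ 2 * (xr 0 w - mu) ^+ 2.
  by rewrite yE exprMn.
rewrite (eq_mean _ E) meanZ// exprVn sqr_sqrtr ?mulVf ?gt_eqF// ltW//.
Qed.

Hypothesis hindep : independent_family P (innovation_pair eta a).

Lemma cvg_autocorr_standardized_power (m : nat) (c : 'I_m -> R) :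
  mean P \1_(autocorr_event standardized_power n c) @[n --> \oo] -->
  \prod_(i < m) gauss_cdf (c i).
Proof.
have [_ _ h3 h4] := @quartic_growth R.
apply: (@cvg_autocorr _ _ _ P standardized_power m
  (mean P (fun w => (1 + `|standardized_power 0 w|) ^+ 3))
  (mean P (fun w => (standardized_power 0 w ^+ 2 - 1) ^+ 2))).
- exact: measurable_standardized_power.
- by move=> k; exact: independent_seq_comp.
- exact: int_y4.
- exact: mean_y1.
- exact: mean_y2.
- exact: mean_quartic h3.
- exact: mean_quartic h4.
Qed.

Lemma power_autocorr_event (m n : nat) (c : 'I_m -> R) : (0 < n)%N ->
  [set w | forall i : 'I_m, Num.sqrt n%:R * sample_autocorr n
     (fun t => `|observed_return vol eta a t w| `^ delta) i.+1 <= c i] =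
  autocorr_event standardized_power n c.
Proof.
move=> n0; apply/seteqP.
have E w i : sample_autocorr n (fun t => `|observed_return vol eta a t w| `^ delta) i =
    sample_autocorr n (standardized_power ^~ w) i.
  have -> : (fun t => `|observed_return vol eta a t w| `^ delta) =
      (fun t => mu + tau * standardized_power t w).
    apply/funext => t; rewrite yE mulrA divff ?gt_eqF// mul1r addrCA subrr addr0.
    by [].
  by rewrite sample_autocorr_affine// gt_eqF.
by split=> w h i; have := h i; rewrite E.
Qed.

End power_returns.

Theorem proposition2p1 (R : realType) (disp : measure_display)
    (T : measurableType disp) (P : probability T R)
    (delta sigma : R) (vol : int -> T -> R)
    (eta : int -> {RV P >-> R}) (a : int -> {RV P >-> bool})
    (hdelta : 0 < delta)
    (hsigma : 0 < sigma)
    (hvol : forall t w, vol t w = sigma)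
    (hindep : independent_family P (innovation_pair eta a))
    (hmean : forall t : int, cond_expectation P (eta t) [set w | a t w] = 0%E)
    (hvar : forall t : int,
       cond_expectation P (fun w => eta t w ^+ 2) [set w | a t w] = 1%E)
    (hident : identically_distributed P (innovation_pair eta a))
    (hmoment : forall t : int,
       ('E_P[(fun w => `|eta t w| `^ (4 * delta))%R] < +oo)%E)
    (ha : forall t : int, (0 < P [set w | a t w] < 1)%E)
    (m : nat) (hm : (1 <= m)%N) :
  cvg_in_distribution P
    (fun (n : nat) (w : T) =>
       Num.sqrt n%:R *: power_autocorr_vector delta m n
         (fun t => observed_return vol eta a t w))
    (mvnormal 0 1%:M).
Proof.
move=> x _; rewrite joint_cdf_std_normal.
pose Y := standardized_power delta sigma vol eta a.
have limY : mean P \1_(autocorr_event Y n (fun i : 'I_m => x 0 i)) @[n --> \oo] -->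
    \prod_(i < m) gauss_cdf (x 0 i).
  exact: cvg_autocorr_standardized_power.
have mY t : measurable_fun setT (Y t) by exact: measurable_standardized_power.
apply: cvg_trans (cvg_comp _ EFin limY _); last first.
  by move=> A; exact.
(* The identification of the events requires [0 < n], so it holds from [n = 1] on. *)
apply: near_eq_cvg; near=> n.
have n0 : (0 < n)%N by near: n; exists 1%N.
rewrite /= mean_indic; last exact: measurable_autocorr_event.
rewrite fineK; last by apply: fin_num_measure; exact: measurable_autocorr_event.
rewrite /joint_cdf -(power_autocorr_event hdelta hsigma hvol hvar hmoment ha)//.
congr (P _); apply/seteqP; split=> w h i; have := h i; by rewrite !mxE.
Unshelve. all: by end_near. Qed.
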